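(* Let $d\ge 2$ be an integer and let $w(n)$, $n=1,2,\ldots$, be an increasing numerical sequence satisfying $w(n^2)\le C\,w(n)$ for all $n\ge 1$, with some constant $C$. Then: (i) $w(n)$ is an RC-multiplier for the one-dimensional trigonometric system $\mathscr T_1$ if and only if it is an RC-multiplier for the $d$-dimensional (multiple) trigonometric system $\mathscr T_d$; (ii) $w(n)$ is an SRC-multiplier for $\mathscr T_1$ if and only if it is an SRC-multiplier for $\mathscr T_d$.
   Context: Let $\mathbb T=\mathbb R/\mathbb Z$ and equip $\mathbb T^d$ with normalized Lebesgue measure. The $d$-dimensional trigonometric system $\mathscr T_d$ is the collection of functions $t_{\mathbf n}(\mathbf x)=\exp(2\pi i(n_1x_1+\cdots+n_dx_d))$, $\mathbf x=(x_1,\ldots,x_d)\in\mathbb T^d$, $\mathbf n=(n_1,\ldots,n_d)\in\mathbb Z^d$. It is regarded as a sequence $\{\phi_n\}_{n\ge1}$ via any enumeration; the notions of RC- and SRC-multiplier below do not depend on the enumeration. Weyl multiplier: a sequence of positive numbers $w(n)\nearrow\infty$ is a Weyl multiplier (for almost everywhere convergence) for an orthonormal system $\{\phi_n\}_{n\ge 1}$ if every series $\sum_{n=1}^\infty a_n\phi_n(x)$ whose coefficients satisfy $\sum_{n=1}^\infty |a_n|^2w(n)<\infty$ converges almost everywhere. RC-multiplier: a sequence of positive numbers $w(n)\nearrow\infty$ is an RC-multiplier for an orthonormal system $\{\phi_n\}_{n\ge1}$ if it is a Weyl multiplier for every system $\{\phi_{n_k}\}_{k\ge 1}$, where $\{n_k\}$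 is a sequence of distinct natural numbers (not necessarily increasing). SRC-multiplier: a sequence of positive numbers $w(n)\nearrow\infty$ is an SRC-multiplier (strong RC-multiplier) for an orthonormal system $\{\phi_n\}_{n\ge1}$ if it is a Weyl multiplier for every orthonormal system of non-overlapping polynomials $p_n(x)=\sum_{k\in G_n}a_k\phi_k(x)$, $n=1,2,\ldots$, where the $G_n$ are pairwise disjoint finite sets of natural numbers. *)

(* Defs.v *)
From HB Require Import structures.
From mathcomp Require Import all_boot all_order all_algebra finmap.
From mathcomp Require Import all_classical all_reals all_analysis.
From mathcomp Require Import complex.

Set Implicit Arguments.
Unset Strict Implicit.
Unset Printing Implicit Defensive.

Import Order.TTheory GRing.Theory Num.Theory.
Import numFieldNormedType.Exports.

Local Open Scope classical_set_scope.
Local Open Scope ring_scope.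
Local Open Scope complex_scope.

(* Sequences of functions and of coefficients are indexed from 0: [phi k],
   [a k] stand for $\phi_{k+1}$, $a_{k+1}$.  Weights keep the index of the
   mathematics, [w n] for $n \geq 1$ (the value [w 0] is never used), so that
   [phi k] goes with the weight [w k.+1]. *)

Section Multipliers.
Context d (T : measurableType d) (R : realType).
Variable mu : {measure set T -> \bar R}.

Definition inner (f g : T -> R[i]) : R[i] :=
  (\int[mu]_x complex.Re (f x * conjc (g x)))
    +i* (\int[mu]_x complex.Im (f x * conjc (g x))).

Definition square_integrable (f : T -> R[i]) :=
  (fun x => complex.Re (f x)) \in Lfun mu 2%:E /\
  (fun x => complex.Im (f x)) \in Lfun mu 2%:E.

Definition orthonormal_system (phi : nat -> T -> R[i]) :=
  (forall n, square_integrable (phi n)) /\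
  (forall m n, inner (phi m) (phi n) = (m == n)%:R).

(* $0 < w(n) \nearrow \infty$, $n \geq 1$ *)
Definition weight_sequence (w : nat -> R) :=
  [/\ forall n, (0 < n)%N -> 0 < w n,
      forall m n, (0 < m)%N -> (m <= n)%N -> w m <= w n
    & w n @[n --> \oo] --> +oo].

(* [R[i]^o] carries the usual topology of the complex plane. *)
Definition weyl_multiplier (phi : nat -> T -> R[i]) (w : nat -> R) :=
  weight_sequence w /\
  forall a : nat -> R[i],
    (\sum_(0 <= k <oo) ((Normc.normc (a k)) ^+ 2 * w k.+1)%:E < +oo)%E ->
    {ae mu, forall x, cvgn (series (fun k => a k * phi k x : R[i]^o))}.

Definition RC_multiplier (phi : nat -> T -> R[i]) (w : nat -> R) :=
  weight_sequence w /\
  forall nk : nat -> nat, injective nk -> weyl_multiplier (phi \o nk) w.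

Definition polynomials (phi : nat -> T -> R[i]) (G : nat -> {fset nat})
    (a : nat -> R[i]) (n : nat) (x : T) : R[i] :=
  \sum_(k <- G n) a k * phi k x.

Definition SRC_multiplier (phi : nat -> T -> R[i]) (w : nat -> R) :=
  weight_sequence w /\
  forall (G : nat -> {fset nat}) (a : nat -> R[i]),
    (forall m n, m != n -> [disjoint G m & G n]%fset) ->
    orthonormal_system (polynomials phi G a) ->
    weyl_multiplier (polynomials phi G a) w.

End Multipliers.

Section Torus.
Variable R : realType.

Definition torus_point d := d.-tuple (measurableTypeR R).

Definition cons_point d (p : measurableTypeR R * torus_point d) :
    torus_point d.+1 :=
  [tuple of p.1 :: p.2].

Lemma measurable_cons_point d : measurable_fun setT (@cons_point d).
Proof. exact: (measurable_cons measurable_fst measurable_snd). Qed.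

HB.instance Definition _ d := @isMeasurableFun.Build _ _ _ _
  (@cons_point d) (@measurable_cons_point d).

(* $\mathbb T = \mathbb R/\mathbb Z$ is represented by its fundamental domain
   [0, 1]: functions on $\mathbb T^d$ are 1-periodic functions on $\mathbb R^d$
   and the normalized Lebesgue measure is the d-fold product of the uniform
   probability on [0, 1]. *)
Fixpoint torus_measure d : probability (torus_point d) R :=
  match d with
  | 0 => \d_ ([tuple] : torus_point 0)
  | d'.+1 => distribution
      (uniform_prob (@ltr01 R) \x torus_measure d')%E (@cons_point d')
  end.

Lemma torus_measure_box d (A : 'I_d -> set R) :
  (forall i, measurable (A i)) ->
  torus_measure d [set x | forall i, A i (tnth x i)] =
  (\prod_(i < d) lebesgue_measure (A i `&` `[0%R, 1%R]))%E.
Proof.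
elim: d A => [|d IH] A mA /=.
  by rewrite big_ord0 diracE (_ : _ \in _)// inE /=; case.
rewrite big_ord_recl -(IH (fun i => A (lift ord0 i)))//.
rewrite /distribution /pushforward.
rewrite (_ : _ @^-1` _ = A ord0 `*`
    [set x : torus_point d | forall i, A (lift ord0 i) (tnth x i)]).
  rewrite product_measure1E//.
    congr (_ * _)%E.
    rewrite [LHS](integral_uniform_pdf 0 1 (A ord0)).
    rewrite (eq_integral (cst 1%E)).
      rewrite integral_cst//= ?mul1e//.
      by apply: measurableI => //; exact: (mA ord0).
    move=> x; rewrite inE/= => -[_]; rewrite in_itv/= /uniform_pdf => ->.
    by rewrite subr0 invr1.
    exact: (mA ord0).
  rewrite (_ : [set _ | _] = \big[setI/setT]_(i < d)
      ((fun x : torus_point d => tnth x i) @^-1` A (lift ord0 i))).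
    apply: bigsetI_measurable => i _.
    have := @measurable_tnth _ (measurableTypeR R) d i.
    by move=> /(_ measurableT _ (mA (lift ord0 i))); rewrite setTI.
  apply/seteqP; split => x /=.
    by move=> h; elim/big_ind : _ => //= A1 B1 h1 h2; split.
  by move=> h i; move: h; rewrite (bigD1 i)//= => -[].
apply/seteqP; split => -[x y] /=.
  move=> h; split; first exact: (h ord0).
  by move=> i; have := h (lift ord0 i); rewrite tnthS.
move=> [h1 h2] i; case: (unliftP ord0 i) => [j ->|->]; last exact: h1.
by rewrite tnthS.
Qed.

(* $t_{\mathbf n}(\mathbf x) = e^{i\theta} = \cos\theta + i \sin\theta$ with
   $\theta = 2\pi(n_1 x_1 + \dots + n_d x_d)$ *)
Definition trig_fun d (n : d.-tuple int) (x : torus_point d) : R[i] :=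
  let theta := 2 * pi * \sum_(i < d) (tnth n i)%:~R * (tnth x i : R) in
  cos theta +i* sin theta.

End Torus.

(* Main.v *)
Require Import Defs.
From mathcomp Require Import all_boot all_order all_algebra finmap.
From mathcomp Require Import all_classical all_reals all_analysis measurable_realfun.
From mathcomp Require Import complex ring lra.

Set Implicit Arguments.
Unset Strict Implicit.
Unset Printing Implicit Defensive.

Import Order.TTheory GRing.Theory Num.Theory.
Import numFieldNormedType.Exports.

Local Open Scope classical_set_scope.
Local Open Scope ring_scope.

(** Going from [d] dimensions to one is easy: [n |-> (n, 0, ..., 0)] turns a
    series on the circle into one on the [d]-torus that depends on the first
    coordinate only, with the same coefficients, and a null set of the torus
    meets almost every fiber of the first coordinate in a null set
    ([ae_first_coordinate]).

    For the converse, let [sum_n a_n p_n] be a series of orthonormal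
    trigonometric polynomials with disjoint spectra on the [d]-torus such that
    [sum_n |a_n|^2 w(n) < oo].  Since [w] tends to infinity, the indices can be
    cut into consecutive blocks such that [w >= 4^j w(1)] on the [j]-th one
    ([weight_blocks]).  Two things have to be shown.

    - The block sums are absolutely summable almost everywhere: by
      orthonormality the [L^2] norm of the [j]-th one is [O(2^-j)]
      ([block_sums_summable]).

    - The largest partial sum inside a block tends to 0 almost everywhere
      ([maximal_block_small]).  This is where the one-dimensional hypothesis
      enters.  For an integer [Q] consider the curve
      [y |-> (Q y, Q^2 y, ..., Q^d y)] in the torus.  Along it, the character of
      frequency [n] becomes the one-dimensional character of frequency
      [Q n_1 + ... + Q^d n_d], and this map of frequencies is injective on a
      given finite set as soon as [Q] is large.  Choose such a [Q_j] for each
      block, growing fast enough for the images of different blocks to be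
      disjoint: the resulting one-dimensional series has the same coefficients
      in the same order and converges almost everywhere, so its partial sums
      inside the [j]-th block tend to 0.  On the other hand the curve
      equidistributes as [Q] grows ([mean_curve]), so that the transferred block
      has nearly the distribution of the original one and is nearly independent
      of the previously transferred blocks.  If, on the torus, the probabilities
      that a block has a partial sum above a threshold had a divergent sum, then,
      as in the second Borel-Cantelli lemma, infinitely many transferred blocks
      would be large with positive probability ([transfer_dichotomy]).  So the
      sum is finite, and almost surely only finitely many blocks are large.

    Events are replaced throughout by Lipschitz functions with values in
    [[0, 1]], for which equidistribution has an explicit error term of order
    [1 / Q].  For convergence of series to pass between the systems, both the
    subsequences of the RC property and the polynomials of the SRC property are
    described as in [cvg_of_transferred], by finite spectra [G n] and by a map
    of frequencies that separates them. *)

(** * Bounded measurable functions on a probability space *)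

Section Bounded.
Context d (T : measurableType d) (R : realType) (P : probability T R).
Implicit Types f g : T -> R.

Definition bounded_measurable f :=
  measurable_fun setT f /\ exists M, forall x, `|f x| <= M.

Lemma bounded_measurable_integrable f : bounded_measurable f -> P.-integrable setT (EFin \o f).
Proof.
move=> [mf [M fM]]; apply: (@measurable_bounded_integrable _ _ _ P) => //.
  by rewrite (le_lt_trans (probability_le1 P measurableT))// ltry.
exists M; split; first exact: num_real.
move=> x /ltW Mx y _ /=; apply: (le_trans _ Mx); exact: fM.
Qed.

Lemma bounded_measurable_cst c : bounded_measurable (cst c).
Proof. by split; [exact: measurable_cst|exists `|c|]. Qed.

Lemma bounded_measurableD f g : bounded_measurable f -> bounded_measurable g ->
  bounded_measurable (fun x => f x + g x).
Proof.
move=> [mf [M fM]] [mg [N gN]]; split; first exact: measurable_funD.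
by exists (M + N) => x; rewrite (le_trans (ler_normD _ _))// lerD.
Qed.

Lemma bounded_measurableM f g : bounded_measurable f -> bounded_measurable g ->
  bounded_measurable (fun x => f x * g x).
Proof.
move=> [mf [M fM]] [mg [N gN]]; split; first exact: measurable_funM.
by exists (M * N) => x; rewrite normrM ler_pM.
Qed.

Lemma bounded_measurableZ c f : bounded_measurable f -> bounded_measurable (fun x => c * f x).
Proof. by move=> bf; apply: (bounded_measurableM (bounded_measurable_cst c) bf). Qed.

Lemma bounded_measurableN f : bounded_measurable f -> bounded_measurable (fun x => - f x).
Proof.
move=> [mf [M fM]]; split; first exact: measurableT_comp.
by exists M => x; rewrite normrN.
Qed.

Lemma bounded_measurableB f g : bounded_measurable f -> bounded_measurable g ->
  bounded_measurable (fun x => f x - g x).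
Proof. by move=> bf bg; apply: (bounded_measurableD bf (bounded_measurableN bg)). Qed.

Lemma mean_cst c : \int[P]_x c = c.
Proof.
rewrite Rintegral_cst//.
by have /= -> := @probability_setT _ _ _ P; rewrite /= mulr1.
Qed.

Lemma meanD f g : bounded_measurable f -> bounded_measurable g ->
  \int[P]_x (f x + g x) = \int[P]_x f x + \int[P]_x g x.
Proof. by move=> bf bg; rewrite RintegralD//; exact: bounded_measurable_integrable. Qed.

Lemma meanB f g : bounded_measurable f -> bounded_measurable g ->
  \int[P]_x (f x - g x) = \int[P]_x f x - \int[P]_x g x.
Proof. by move=> bf bg; rewrite RintegralB//; exact: bounded_measurable_integrable. Qed.

Lemma meanZ c f : bounded_measurable f ->
  \int[P]_x (c * f x) = c * \int[P]_x f x.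
Proof. by move=> bf; rewrite RintegralZl//; exact: bounded_measurable_integrable. Qed.

Lemma mean_ge0 f : (forall x, 0 <= f x) -> 0 <= \int[P]_x f x.
Proof. by move=> f0; apply: Rintegral_ge0. Qed.

Lemma le_mean f g : bounded_measurable f -> bounded_measurable g ->
  (forall x, f x <= g x) -> \int[P]_x f x <= \int[P]_x g x.
Proof.
move=> bf bg fg; rewrite -subr_ge0 -meanB//; apply: mean_ge0 => x.
by rewrite subr_ge0.
Qed.

Lemma mean_le1 f : bounded_measurable f -> (forall x, f x <= 1) ->
  \int[P]_x f x <= 1.
Proof. by move=> bf f1; rewrite -[leRHS]mean_cst le_mean//; exact: bounded_measurable_cst. Qed.

Lemma mean_dist f g c : bounded_measurable f -> bounded_measurable g ->
  (forall x, `|f x - g x| <= c) -> `|\int[P]_x f x - \int[P]_x g x| <= c.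
Proof.
move=> bf bg fg; rewrite -meanB// ler_norml.
have bfg := bounded_measurableB bf bg.
apply/andP; split.
  rewrite -[leLHS]mean_cst; apply: le_mean => //; first exact: bounded_measurable_cst.
  by move=> x; have := fg x; rewrite ler_norml => /andP[].
rewrite -[leRHS]mean_cst; apply: le_mean => //; first exact: bounded_measurable_cst.
by move=> x; have := fg x; rewrite ler_norml => /andP[].
Qed.

Lemma mean_norm_le f c : bounded_measurable f -> (forall x, `|f x| <= c) ->
  `|\int[P]_x f x| <= c.
Proof.
move=> bf fc; rewrite -[X in `|X|]subr0 -[X in _ - X](mean_cst 0).
by apply: mean_dist => // [|x]; [exact: bounded_measurable_cst|rewrite subr0].
Qed.

Lemma EFin_mean f : bounded_measurable f ->
  (\int[P]_x f x)%:E = (\int[P]_x (f x)%:E)%E.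
Proof.
by move=> bf; rewrite /Rintegral fineK//; apply: integrable_fin_num => //;
  exact: bounded_measurable_integrable.
Qed.

(** Monotone convergence. Every almost-everywhere statement of the proof is
    obtained from this one. *)
Lemma ae_summable (f : nat -> T -> R) (M : R) :
  (forall n, bounded_measurable (f n)) -> (forall n x, 0 <= f n x) ->
  (forall n, \sum_(k < n) \int[P]_x f k x <= M) ->
  {ae P, forall x, cvgn (series (f ^~ x))}.
Proof.
move=> bf f0 fM.
have mf n : measurable_fun setT (fun x => (f n x)%:E).
  by apply/measurable_EFinP; exact: (bf n).1.
have fin : (\int[P]_x (\sum_(n <oo) (f n x)%:E) < +oo)%E.
  rewrite integral_nneseries//; last by move=> n x _; rewrite lee_fin.
  apply: (@le_lt_trans _ _ M%:E); last by rewrite ltry.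
  apply: lime_le; first by apply: is_cvg_nneseries => n _ _; apply: integral_ge0 => x _; rewrite lee_fin.
  apply: nearW => n.
  under eq_bigr do rewrite -EFin_mean//.
  by rewrite sumEFin lee_fin big_mkord.
have mS : measurable_fun setT (fun x => (\sum_(n <oo) (f n x)%:E)%E).
  by apply: (ge0_emeasurable_sum (P := xpredT)) => // n x _ _; rewrite lee_fin.
have iS : P.-integrable setT (fun x => (\sum_(n <oo) (f n x)%:E)%E).
  apply/integrableP; split => //.
  rewrite (eq_integral (fun x => (\sum_(n <oo) (f n x)%:E)%E))// => x _.
  by rewrite gee0_abs// nneseries_ge0// => n _ _; rewrite lee_fin.
have := integrable_ae measurableT iS.
apply: filterS => x /(_ I) h.
have nd : nondecreasing_seq (series (f ^~ x)).
  by apply/nondecreasing_seqP => n; rewrite seriesSr lerDl.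
apply: nondecreasing_is_cvgn => //.
have S0 : (0 <= \sum_(n <oo) (f n x)%:E)%E.
  by apply: nneseries_ge0 => n _ _; rewrite lee_fin.
exists (fine (\sum_(n <oo) (f n x)%:E)%E) => _ [n _ <-].
rewrite -lee_fin fineK// /series/= -sumEFin.
by apply: nneseries_lim_ge => k _; rewrite lee_fin.
Qed.

End Bounded.

(** * Means over the unit interval *)

Section UnitInterval.
Variable R : realType.
Local Notation U := (uniform_prob (@ltr01 R)).

Lemma mean_FTC2 (h Phi : R -> R) : continuous h -> bounded_measurable h ->
  (forall t : R, 0 <= t <= 1 -> is_derive t 1 Phi (h t)) ->
  \int[U]_t h t = Phi 1 - Phi 0.
Proof.
move=> ch bh dPhi; have [mh [M hM]] := bh.
(* The density formula is applied to a nonnegative function, hence the shift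
   by M. *)
have key : \int[U]_t (h t + M) = Phi 1 + M - Phi 0.
  have bhM : bounded_measurable (fun t => h t + M) by apply: bounded_measurableD => //; exact: bounded_measurable_cst.
  apply: EFin_inj; rewrite (EFin_mean U bhM) integral_uniform; last 2 first.
  - by apply/measurable_EFinP; exact: bhM.1.
  - by move=> x; rewrite lee_fin; have := hM x; rewrite ler_norml; lra.
  rewrite subr0 invr1 mul1e.
  pose Psi t := Phi t + M * t.
  have dPsi (t : R) : 0 <= t <= 1 -> is_derive t 1 Psi (h t + M).
    move=> t01; have ? := dPhi _ t01.
    rewrite /Psi; apply: is_derive_eq.
    by rewrite /GRing.scale/= mulr1.
  rewrite (@continuous_FTC2 _ _ Psi) ?ltr01//.
  - by rewrite /Psi -EFinB mulr0 mulr1 addr0.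
  - by apply: continuous_subspaceT => x; apply: cvgD; [exact: ch|exact: cvg_cst].
  - have cPsi (t : R) : 0 <= t <= 1 -> {for t, continuous Psi}.
      by move=> /dPsi ?; apply/differentiable_continuous/derivable1_diffP.
    split.
    + by move=> x; rewrite in_itv/= => /andP[/ltW ? /ltW x1];
        have ? := dPsi x; apply: ex_derive; apply: dPsi; apply/andP.
    + by apply: cvg_at_right_filter; apply: cPsi; rewrite lexx ler01.
    + by apply: cvg_at_left_filter; apply: cPsi; rewrite lexx ler01.
  - move=> x; rewrite in_itv/= => /andP[/ltW ? /ltW x1].
    by rewrite derive1E; apply: derive_val; apply: dPsi; apply/andP.
have := key; rewrite meanD//; last exact: bounded_measurable_cst.
by rewrite mean_cst; lra.
Qed.

Definition clamp (x : R) : R := Num.max 0 (Num.min 1 x).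

Lemma clamp01 x : 0 <= clamp x <= 1.
Proof. by rewrite /clamp le_max lexx/= ge_max ler01 ge_min lexx. Qed.

Lemma clamp_id x : 0 <= x <= 1 -> clamp x = x.
Proof. by move=> /andP[x0 x1]; rewrite /clamp min_r// max_r. Qed.

Lemma measurable_clamp : measurable_fun setT clamp.
Proof.
by apply: measurable_maxr; [exact: measurable_cst|apply: measurable_minr];
  [exact: measurable_cst|exact: measurable_id].
Qed.

(** The uniform law does not see what happens outside the unit interval; this
    is how pointwise bounds that hold on the interval only are used. *)
Lemma mean_clamp (f : R -> R) : bounded_measurable f ->
  \int[U]_x f x = \int[U]_x f (clamp x).
Proof.
move=> bf; have [mf [M fM]] := bf.
have bfc : bounded_measurable (f \o clamp).
  by split; [exact: measurableT_comp measurable_clamp|exists M => x /=].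
have cM : bounded_measurable (cst M : R -> R) by exact: bounded_measurable_cst.
apply: (addIr M); rewrite -[M in LHS](mean_cst U) -[M in RHS](mean_cst U).
rewrite -meanD// -meanD//; apply: EFin_inj.
have f0 x : 0 <= f x + M by have := fM x; rewrite ler_norml; lra.
rewrite !EFin_mean//; try exact: bounded_measurableD.
rewrite !integral_uniform//.
- congr (_ * _)%E; apply: eq_integral => x; rewrite inE/= in_itv/= => x01.
  by rewrite clamp_id.
- by apply/measurable_EFinP; exact: (bounded_measurableD bfc cM).1.
- by move=> x; rewrite lee_fin; exact: f0.
- by apply/measurable_EFinP; exact: (bounded_measurableD bf cM).1.
Qed.

Lemma mean_dist_unit (f g : R -> R) (c : R) :
  bounded_measurable f -> bounded_measurable g ->
  (forall x, 0 <= x <= 1 -> `|f x - g x| <= c) ->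
  `|\int[U]_x f x - \int[U]_x g x| <= c.
Proof.
have bc (h : R -> R) : bounded_measurable h -> bounded_measurable (h \o clamp).
  move=> [mh [M hM]].
  by split; [exact: measurableT_comp measurable_clamp|exists M => x /=].
move=> bf bg fg; rewrite (mean_clamp bf) (mean_clamp bg).
apply: (@mean_dist _ _ _ U (f \o clamp) (g \o clamp)) => [||x]; [exact: bc|exact: bc|].
by apply: fg; exact: clamp01.
Qed.

Lemma primitive_exists (h : R -> R) : continuous h ->
  exists Phi, forall t : R, 0 <= t <= 1 -> is_derive t 1 Phi (h t).
Proof.
move=> ch; exists (fun x => \int[lebesgue_measure]_(t in `[-1, x]) h t).
move=> t /andP[t0 t1].
have ih : lebesgue_measure.-integrable `[-1, 2] (EFin \o h).
  apply: continuous_compact_integrable; first exact: segment_compact.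
  by apply: continuous_subspaceT.
have t2 : t < 2 by lra.
have t1' : -1 < t by lra.
have [dF F'] := @continuous_FTC1_closed R h (-1) t 2 t2 ih t1' (ch t).
by rewrite -F' derive1E; exact: derivableP.
Qed.

Lemma mean_subdivide (g : R -> R) (Q : nat) : (0 < Q)%N ->
  continuous g -> bounded_measurable g ->
  \int[U]_t g t =
  Q%:R^-1 * \sum_(k < Q) \int[U]_v g ((v + k%:R) / Q%:R).
Proof.
move=> Q0 cg bg; have [Phi dPhi] := primitive_exists cg.
have Qn0 : Q%:R != 0 :> R by rewrite pnatr_eq0 -lt0n.
have Qp : 0 < Q%:R :> R by rewrite ltr0n.
rewrite (mean_FTC2 cg bg dPhi).
have E (k : 'I_Q) : \int[U]_v g ((v + k%:R) / Q%:R) =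
    Q%:R * (Phi (k.+1%:R / Q%:R) - Phi (k%:R / Q%:R)).
  have caff : continuous (fun v : R => (v + k%:R) / Q%:R).
    by move=> v; apply: cvgM; [apply: cvgD; [exact: cvg_id|exact: cvg_cst]|exact: cvg_cst].
  have c1 : continuous (fun v : R => g ((v + k%:R) / Q%:R)).
    by move=> v; apply: continuous_comp; [exact: caff|exact: cg].
  have c2 : bounded_measurable (fun v : R => g ((v + k%:R) / Q%:R)).
    split; first exact: continuous_measurable_fun.
    by have [_ [M gM]] := bg; exists M.
  have c3 (v : R) : 0 <= v <= 1 ->
      is_derive v 1 (fun v => Q%:R * Phi ((v + k%:R) / Q%:R)) (g ((v + k%:R) / Q%:R)).
    move=> /andP[v0 v1].
    have kQ : k%:R + 1 <= Q%:R :> R by rewrite natr1 ler_nat.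
    have k0 : 0 <= k%:R :> R by [].
    have /dPhi ? : 0 <= (v + k%:R) / Q%:R <= 1.
      by rewrite divr_ge0 ?addr_ge0 ?(ltW Qp)//= ler_pdivrMr// mul1r; lra.
    have d1 : is_derive v 1 (fun v : R => (v + k%:R) / Q%:R) (Q%:R^-1).
      apply: is_derive_eq.
      by rewrite /GRing.scale/= !mulr0 ?add0r ?addr0 ?mulr1.
    have d2 : is_derive v 1 (fun v => Phi ((v + k%:R) / Q%:R))
       (g ((v + k%:R) / Q%:R) * Q%:R^-1).
      exact: (@is_derive1_comp R Phi (fun v => (v + k%:R) / Q%:R)).
    apply: is_derive_eq.
    by rewrite /GRing.scale/= mulrCA mulfV ?mulr1.
  rewrite (mean_FTC2 c1 c2 c3).
  by rewrite add0r (addrC 1 k%:R) natr1 mulrBr.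
under eq_bigr do rewrite E.
rewrite -mulr_sumr mulKf// -(big_mkord xpredT (fun k => Phi (k.+1%:R / Q%:R) - Phi (k%:R / Q%:R))).
by rewrite telescope_sumr// mulfV// mul0r.
Qed.

Lemma lipschitz_continuous (h : R -> R) (L : R) :
  (forall x y, `|h x - h y| <= L * `|x - y|) -> continuous h.
Proof.
move=> hL x; apply/cvgrPdist_le => /= e e0.
near=> y.
apply: (le_trans (hL x y)).
have L1 : 0 < `|L| + 1 by rewrite ltr_wpDl.
apply: (@le_trans _ _ ((`|L| + 1) * `|x - y|)).
  by apply: ler_wpM2r => //; rewrite (le_trans (ler_norm _))// lerDl.
rewrite -ler_pdivlMl// mulrC.
near: y; apply: cvgr_dist_le; first exact: cvg_id.
by rewrite divr_gt0.
Unshelve. all: by end_near. Qed.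

(** Two-variable equidistribution. Cut the interval into [Q] pieces, on each of
    which [Q y] runs through a full period while [y] moves by [1 / Q] only, so
    that the slow variable can be averaged independently of the fast one at the
    cost of the Lipschitz bound. The constant [M] does not enter the error
    term: this is what makes the induction on the dimension in [mean_curve]
    possible. *)
Lemma mean_fast_variable (B : R -> R -> R) (L M : R) (Q : nat) :
  (0 < Q)%N -> 0 <= L ->
  (forall y u, 0 <= B y u <= 1) ->
  (forall y y' u, `|B y u - B y' u| <= L * `|y - y'|) ->
  (forall y u u', `|B y u - B y u'| <= M * `|u - u'|) ->
  (forall y u (k : nat), B y (u + k%:R) = B y u) ->
  `|\int[U]_y B y (Q%:R * y) - \int[U]_y \int[U]_u B y u| <= L / Q%:R.
Proof.
move=> Q0 L0 B01 BL BM Bper.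
have Qn0 : Q%:R != 0 :> R by rewrite pnatr_eq0 -lt0n.
have Qp : 0 < Q%:R :> R by rewrite ltr0n.
have bounded1 (g : R -> R) : continuous g -> (forall x, 0 <= g x <= 1) ->
    bounded_measurable g.
  move=> cg g01; split; first exact: continuous_measurable_fun.
  by exists 1 => x; rewrite ler_norml; have := g01 x; lra.
have cBy y : continuous (B y) by exact: lipschitz_continuous (BM y).
have bBy y : bounded_measurable (B y) by exact: bounded1.
pose A (y : R) := \int[U]_u B y u.
have cA : continuous A.
  apply: (@lipschitz_continuous _ L) => y y'; apply: mean_dist; [exact: bBy|exact: bBy|].
  by move=> u; exact: BL.
have bA : bounded_measurable A.
  apply: bounded1 => // y; apply/andP; split.
    by apply: mean_ge0 => x; have /andP[] := B01 y x.
  by apply: mean_le1; [exact: bBy|] => x; have /andP[] := B01 y x.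
pose D (y : R) := B y (Q%:R * y).
have cD : continuous D.
  apply: (@lipschitz_continuous _ (L + M * Q%:R)) => y y'.
  rewrite /D (_ : B y (Q%:R * y) - _ = (B y (Q%:R * y) - B y' (Q%:R * y)) +
    (B y' (Q%:R * y) - B y' (Q%:R * y'))); last by ring.
  apply: (le_trans (ler_normD _ _)); rewrite mulrDl lerD//.
  by rewrite (le_trans (BM _ _ _))// -mulrBr normrM ger0_norm// mulrA.
have bD : bounded_measurable D by apply: bounded1 => // y; exact: B01.
have aff (k : nat) : continuous (fun v : R => (v + k%:R) / Q%:R).
  by move=> v; apply: cvgM; [apply: cvgD; [exact: cvg_id|exact: cvg_cst]|exact: cvg_cst].
rewrite (mean_subdivide Q0 cD bD) (mean_subdivide Q0 cA bA) -mulrBr -sumrB.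
rewrite normrM gtr0_norm ?invr_gt0// mulrC ler_pM2r ?invr_gt0//.
apply: (le_trans (ler_norm_sum _ _ _)).
rewrite (_ : L = \sum_(k < Q) L / Q%:R); last first.
  by rewrite sumr_const card_ord -[RHS]mulr_natr divfK.
apply: ler_sum => k _.
have comp_b (g : R -> R) : bounded_measurable g -> bounded_measurable (fun v : R => g ((v + k%:R) / Q%:R)).
  move=> [mg [N gN]]; split; last by exists N.
  by apply: measurableT_comp => //; apply: continuous_measurable_fun.
(* By periodicity the fast variable is u itself on the k-th piece. The first
   integral is the mean over the diagonal v = u, written here as the mean over v
   of a constant. *)
rewrite [X in `|X - _|](_ : _ = \int[U]_v \int[U]_u B ((u + k%:R) / Q%:R) u); last first.
  rewrite mean_cst; apply: eq_Rintegral => v _; rewrite /D.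
  by rewrite mulrCA mulfV// mulr1 Bper.
have bdiag : bounded_measurable (fun u : R => B ((u + k%:R) / Q%:R) u).
  have [mD' [N DN]] := comp_b _ bD.
  have e u : D ((u + k%:R) / Q%:R) = B ((u + k%:R) / Q%:R) u.
    by rewrite /D mulrCA mulfV// mulr1 Bper.
  by split; [rewrite -(funext e)|exists N => u; rewrite -e].
apply: mean_dist_unit; [exact: bounded_measurable_cst|exact: comp_b|] => v v01.
apply: mean_dist_unit => // u u01.
apply: (le_trans (BL _ _ _)); rewrite ler_wpM2l//.
rewrite -mulrBl normrM (gtr0_norm (_ : 0 < Q%:R^-1)) ?invr_gt0//.
by rewrite ler_piMl ?invr_ge0// ?(ltW Qp)// ler_norml; lra.
Qed.


End UnitInterval.

(** * Integration over the torus *)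

Section TorusIntegration.
Variable R : realType.
Local Notation U := (uniform_prob (@ltr01 R)).
Local Notation mu := (torus_measure R).

Lemma bounded_slice d (K : torus_point R d.+1 -> R) y : bounded_measurable K ->
  bounded_measurable (fun x => K (cons_point (y, x))).
Proof.
move=> [mK [M KM]]; split; last by exists M.
apply: measurableT_comp => //; apply: measurableT_comp => //.
Qed.

Lemma mean_torus0 (K : torus_point R 0 -> R) : bounded_measurable K ->
  \int[mu 0]_x K x = K [tuple].
Proof.
move=> [mK _]; rewrite /Rintegral integral_dirac//=; last exact/measurable_EFinP.
by rewrite indicE in_setT mul1r.
Qed.

Lemma bounded_fiber_mean d (K : torus_point R d.+1 -> R) : bounded_measurable K ->
  bounded_measurable (fun y : R => \int[mu d]_x K (cons_point (y, x))).
Proof.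
move=> bK; have [mK [M KM]] := bK.
have mK2 : measurable_fun setT (fun z => K (cons_point z)).
  by apply: measurableT_comp => //; exact: measurable_cons_point.
have iK : (U \x mu d)%E.-integrable setT (fun z => (K (cons_point z))%:E).
  by apply: bounded_measurable_integrable; split => //; exists M.
split.
  apply/measurable_EFinP.
  rewrite (_ : _ \o _ = fubini_F (mu d) (fun z => (K (cons_point z))%:E)).
    exact: (measurable_fubini_F iK).
  apply/funext => y /=; rewrite EFin_mean//; exact: bounded_slice.
exists M => y; apply: mean_norm_le => [|x]; first exact: bounded_slice.
exact: KM.
Qed.

Lemma mean_torusS d (K : torus_point R d.+1 -> R) : bounded_measurable K ->
  \int[mu d.+1]_x K x = \int[U]_y \int[mu d]_x K (cons_point (y, x)).
Proof.
move=> bK; have [mK [M KM]] := bK.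
have mK2 : measurable_fun setT (fun z => K (cons_point z)).
  by apply: measurableT_comp => //; exact: measurable_cons_point.
have iK : (U \x mu d)%E.-integrable setT (fun z => (K (cons_point z))%:E).
  by apply: bounded_measurable_integrable; split => //; exists M.
apply: EFin_inj; rewrite (EFin_mean (mu d.+1) bK) (EFin_mean U (bounded_fiber_mean bK)).
rewrite [LHS]integral_distribution//; last exact/measurable_EFinP.
rewrite -(integral12_prod_meas1 iK); apply: eq_integral => y _.
by rewrite EFin_mean//; exact: bounded_slice.
Qed.

Lemma mean_torus1 (K : torus_point R 1 -> R) : bounded_measurable K ->
  \int[mu 1]_x K x = \int[U]_y K (cons_point (y, [tuple])).
Proof.
move=> bK; rewrite mean_torusS//; apply: eq_Rintegral => y _.
by rewrite mean_torus0//; exact: bounded_slice.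
Qed.

End TorusIntegration.

(** * Equidistribution of curves in the torus *)

Section Mixing.
Variable R : realType.
Local Notation U := (uniform_prob (@ltr01 R)).
Local Notation mu := (torus_measure R).

Lemma tnth_cons0 d (y : R) (x : torus_point R d) : tnth (cons_point (y, x)) ord0 = y.
Proof. by []. Qed.

Lemma tnth_consS d (y : R) (x : torus_point R d) i :
  tnth (cons_point (y, x)) (lift ord0 i) = tnth x i.
Proof. exact: tnthS. Qed.

(** The distance is taken on [R^d], not on the quotient torus; a
    periodic function that is Lipschitz for it is also Lipschitz on the
    quotient. *)
Definition dist1 d (x x' : torus_point R d) : R :=
  \sum_(i < d) `|tnth x i - tnth x' i|.

Lemma dist1_ge0 d (x x' : torus_point R d) : 0 <= dist1 x x'.
Proof. by apply: sumr_ge0. Qed.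

Lemma dist1_cons d y y' (x x' : torus_point R d) :
  dist1 (cons_point (y, x)) (cons_point (y', x')) = `|y - y'| + dist1 x x'.
Proof.
rewrite /dist1 big_ord_recl !tnth_cons0; congr (_ + _).
by apply: eq_bigr => i _; rewrite !tnth_consS.
Qed.

Definition eq_mod1 d (x x' : torus_point R d) :=
  forall i, exists m : int, tnth x i = tnth x' i + m%:~R.

Lemma eq_mod1_cons d y y' (x x' : torus_point R d) (m : int) :
  y = y' + m%:~R -> eq_mod1 x x' ->
  eq_mod1 (cons_point (y, x)) (cons_point (y', x')).
Proof.
move=> yy' xx' i; case: (unliftP ord0 i) => [j ->|->].
  by rewrite !tnth_consS; exact: xx'.
by exists m.
Qed.

(** The bound by 1 is part of the definition because these functions play the
    role of indicators of events: products of them, which stand for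
    intersections, then have the sum of the Lipschitz constants as Lipschitz
    constant. *)
Record lipschitz_periodic d (L : R) (K : torus_point R d -> R) : Prop :=
  LipschitzPeriodic {
    lp_measurable : measurable_fun setT K ;
    lp_unit : forall x, 0 <= K x <= 1 ;
    lp_lipschitz : forall x x', `|K x - K x'| <= L * dist1 x x' ;
    lp_periodic : forall x x', eq_mod1 x x' -> K x = K x' }.

Lemma lipschitz_periodic_bounded d L (K : torus_point R d -> R) : lipschitz_periodic L K ->
  bounded_measurable K.
Proof.
move=> [mK K01 _ _]; split => //; exists 1 => x.
by rewrite ler_norml; have := K01 x; lra.
Qed.

Lemma lipschitz_periodic_slice d L (K : torus_point R d.+1 -> R) y : lipschitz_periodic L K ->
  lipschitz_periodic L (fun x => K (cons_point (y, x))).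
Proof.
move=> lK; have [mK K01 LK pK] := lK; split => //.
- exact: (bounded_slice y (lipschitz_periodic_bounded lK)).1.
- by move=> x x'; rewrite (le_trans (LK _ _))// dist1_cons subrr normr0 add0r.
- by move=> x x' xx'; apply: pK; apply: (@eq_mod1_cons _ _ _ _ _ 0) => //; rewrite addr0.
Qed.

Lemma lipschitz_periodic_cst1 d : lipschitz_periodic 0 (cst 1 : torus_point R d -> R).
Proof.
split => // [x|x x']; first by rewrite /= ler01 lexx.
by rewrite /= subrr normr0 mul0r.
Qed.

Lemma lipschitz_periodicM d L1 L2 (K1 K2 : torus_point R d -> R) :
  lipschitz_periodic L1 K1 -> lipschitz_periodic L2 K2 ->
  lipschitz_periodic (L1 + L2) (fun x => K1 x * K2 x).
Proof.
move=> [m1 u1 l1 p1] [m2 u2 l2 p2]; split.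
- exact: measurable_funM.
- move=> x; have /andP[? ?] := u1 x; have /andP[? ?] := u2 x.
  by rewrite mulr_ge0//= mulr_ile1.
- move=> x x'; rewrite (_ : _ - _ = (K1 x - K1 x') * K2 x + K1 x' * (K2 x - K2 x')); last by ring.
  apply: (le_trans (ler_normD _ _)); rewrite [leRHS]mulrDl lerD// normrM.
    rewrite (le_trans _ (l1 x x'))// ler_piMr//.
    by have /andP[? ?] := u2 x; rewrite ger0_norm.
  rewrite (le_trans _ (l2 x x'))// ler_piMl//.
  by have /andP[? ?] := u1 x'; rewrite ger0_norm.
- by move=> x x' xx'; rewrite (p1 _ _ xx') (p2 _ _ xx').
Qed.

Lemma lipschitz_periodicW d L1 L2 (K : torus_point R d -> R) : L1 <= L2 ->
  lipschitz_periodic L1 K -> lipschitz_periodic L2 K.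
Proof.
move=> L12 [mK uK lK pK]; split => // x x'.
by rewrite (le_trans (lK x x'))// ler_wpM2r// dist1_ge0.
Qed.

Lemma lipschitz_periodic_prod (I : eqType) d (s : seq I) (L : I -> R) (K : I -> torus_point R d -> R) :
  (forall i, i \in s -> lipschitz_periodic (L i) (K i)) ->
  lipschitz_periodic (\sum_(i <- s) L i) (fun x => \prod_(i <- s) K i x).
Proof.
elim: s => [|i s IH] lK.
  by rewrite big_nil; under eq_fun do rewrite big_nil; exact: lipschitz_periodic_cst1.
rewrite (_ : (fun x => _) = (fun x => K i x * \prod_(j <- s) K j x)); last first.
  by apply/funext => x; rewrite big_cons.
rewrite big_cons; apply: lipschitz_periodicM.
  by apply: lK; rewrite inE eqxx.
by apply: IH => j js; apply: lK; rewrite inE js orbT.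
Qed.

(** The curve [y |-> (Q y, Q^2 y, ..., Q^d y)], in a form that exhibits it as
    the [(d-1)]-dimensional curve followed at speed [Q] (see [tnth_curve]). *)
Fixpoint curve d (Q : nat) (y : R) : torus_point R d :=
  match d with
  | 0 => [tuple]
  | d'.+1 => cons_point (Q%:R * y, curve d' Q (Q%:R * y))
  end.

Lemma measurable_curve d Q : measurable_fun setT (curve d Q).
Proof.
elim: d => [|d IH] /=; first exact: measurable_cst.
apply: measurableT_comp; first exact: measurable_cons_point.
have mQ : measurable_fun [set: R] (fun y : R => Q%:R * y).
  exact: mulrl_measurable.
apply: measurable_fun_pair => //; exact: measurableT_comp.
Qed.

Lemma curve_lipschitz d Q : exists M, 0 <= M /\
  forall y y', dist1 (curve d Q y) (curve d Q y') <= M * `|y - y'|.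
Proof.
elim: d => [|d [M [M0 IH]]].
  by exists 0; split => // y y'; rewrite /dist1 big_ord0 mul0r.
exists ((1 + M) * Q%:R); split; first by rewrite mulr_ge0// addr_ge0.
move=> y y'; rewrite /= dist1_cons -mulrA mulrDl mul1r.
have -> : Q%:R * `|y - y'| = `|Q%:R * y - Q%:R * y'|.
  by rewrite -mulrBr normrM ger0_norm.
by rewrite lerD.
Qed.

Lemma curve_periodic d Q y (m : int) : eq_mod1 (curve d Q (y + m%:~R)) (curve d Q y).
Proof.
elim: d y m => [|d IH] y m /=; first by case.
have E : Q%:R * (y + m%:~R) = Q%:R * y + (Q%:Z * m)%:~R.
  by rewrite mulrDr intrM.
by rewrite E; apply: (eq_mod1_cons (m := Q%:Z * m)) => //; exact: IH.
Qed.

(** Induction on the dimension: with [u = Q y] as fast variable,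
    [mean_fast_variable] replaces [K (y, u, curve u)] by its mean over [y] and
    [u] independent, and for fixed [y] the induction hypothesis applies to the
    remaining variables. Each step costs [L / Q] with the same [L], since at
    each step only one coordinate is the slow one. The first coordinate of
    [K], which runs at speed 1, accommodates functions of the earlier blocks. *)
Lemma mean_curve d L (K : torus_point R d.+1 -> R) Q : (0 < Q)%N -> 0 <= L ->
  lipschitz_periodic L K ->
  `|\int[U]_y K (cons_point (y, curve d Q y)) - \int[mu d.+1]_x K x| <=
  d%:R * (L / Q%:R).
Proof.
move=> Q0 L0; elim: d K => [|d IH] K lK.
  by rewrite mul0r mean_torus1 ?subrr ?normr0//; exact: lipschitz_periodic_bounded lK.
have [M [M0 cM]] := curve_lipschitz d Q.
pose B (y u : R) := K (cons_point (y, cons_point (u, curve d Q u))).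
have [mK K01 LK pK] := lK.
have BM y u u' : `|B y u - B y u'| <= (L * (1 + M)) * `|u - u'|.
  apply: (le_trans (LK _ _)); rewrite !dist1_cons subrr normr0 add0r -mulrA.
  by rewrite ler_wpM2l// mulrDl mul1r lerD.
have BL y y' u : `|B y u - B y' u| <= L * `|y - y'|.
  apply: (le_trans (LK _ _)); rewrite !dist1_cons subrr normr0 add0r.
  by rewrite (_ : dist1 _ _ = 0) ?addr0// /dist1 big1// => i _; rewrite subrr normr0.
have Bper y u (k : nat) : B y (u + k%:R) = B y u.
  apply: pK; apply: (eq_mod1_cons (m := 0)); first by rewrite addr0.
  by rewrite !pmulrn; apply: (eq_mod1_cons (m := k)) => //; exact: curve_periodic.
have := mean_fast_variable Q0 L0 (fun y u => K01 _) BL BM Bper.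
rewrite /= => fast; rewrite mean_torusS; last exact: lipschitz_periodic_bounded lK.
rewrite -natr1 mulrDl mul1r [leRHS]addrC.
rewrite [X in `|X|](_ : _ = (\int[U]_y B y (Q%:R * y) - \int[U]_y \int[U]_u B y u) +
  (\int[U]_y \int[U]_u B y u - \int[U]_y \int[mu d.+1]_x K (cons_point (y, x)))); last first.
  by rewrite addrA subrK.
apply: (le_trans (ler_normD _ _)); apply: lerD; first exact: fast.
have mB y : bounded_measurable (B y).
  split; last by exists 1 => u; rewrite /B ler_norml; have := K01 (cons_point (y, cons_point (u, curve d Q u))); lra.
  by apply: continuous_measurable_fun; exact: lipschitz_continuous (BM y).
apply: mean_dist.
- split.
    apply: continuous_measurable_fun; apply: (@lipschitz_continuous _ _ L) => y y'.
    by apply: mean_dist => [||u]; [exact: mB|exact: mB|exact: BL].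
  exists 1 => y; apply: mean_norm_le => [|u]; first exact: mB.
  by rewrite /B ler_norml; have := K01 (cons_point (y, cons_point (u, curve d Q u))); lra.
- exact: bounded_fiber_mean (lipschitz_periodic_bounded lK).
- move=> y; exact: IH (lipschitz_periodic_slice y lK).
Qed.

End Mixing.

Local Open Scope complex_scope.
Local Notation Re := complex.Re.
Local Notation Im := complex.Im.

(** * Complex-valued functions *)

Section ComplexNumbers.
Variable R : realType.
Implicit Types z u : R[i].

Lemma cReD z u : Re (z + u) = Re z + Re u. Proof. by case: z u => [? ?] []. Qed.
Lemma cImD z u : Im (z + u) = Im z + Im u. Proof. by case: z u => [? ?] []. Qed.
Lemma cReN z : Re (- z) = - Re z. Proof. by case: z. Qed.
Lemma cImN z : Im (- z) = - Im z. Proof. by case: z. Qed.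
Lemma cReM z u : Re (z * u) = Re z * Re u - Im z * Im u.
Proof. by case: z u => [? ?] []. Qed.
Lemma cImM z u : Im (z * u) = Re z * Im u + Im z * Re u.
Proof. by case: z u => [? ?] []. Qed.
Lemma Re_conjc z : Re (conjc z) = Re z. Proof. by case: z. Qed.
Lemma Im_conjc z : Im (conjc z) = - Im z. Proof. by case: z. Qed.
Lemma eq_ReIm z u : Re z = Re u -> Im z = Im u -> z = u.
Proof. by case: z u => [a b] [c e] /= -> ->. Qed.
Lemma conjcD z u : conjc (z + u) = conjc z + conjc u.
Proof. by apply: eq_ReIm; rewrite ?(Re_conjc, Im_conjc, cReD, cImD)// opprD. Qed.
Lemma conjcM z u : conjc (z * u) = conjc z * conjc u.
Proof. by apply: eq_ReIm; rewrite ?(Re_conjc, Im_conjc, cReM, cImM); ring. Qed.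
Lemma conjc_0 : conjc 0 = 0 :> R[i].
Proof. by apply: eq_ReIm; rewrite ?(Re_conjc, Im_conjc)//= oppr0. Qed.

Lemma conjc_sum (I : Type) (s : seq I) (F : I -> R[i]) :
  conjc (\sum_(i <- s) F i) = \sum_(i <- s) conjc (F i).
Proof. exact: (big_morph _ conjcD conjc_0). Qed.

(** This norm, equivalent to the modulus, is used for all pointwise estimates:
    its measurability and Lipschitz properties reduce to those of the real and
    imaginary parts. *)
Definition norm1 z : R := `|Re z| + `|Im z|.

Lemma norm1_ge0 z : 0 <= norm1 z. Proof. exact: addr_ge0. Qed.

Lemma norm1_0 : norm1 0 = 0. Proof. by rewrite /norm1 normr0 addr0. Qed.

Lemma norm1D z u : norm1 (z + u) <= norm1 z + norm1 u.
Proof. by rewrite /norm1 cReD cImD addrACA lerD// ler_normD. Qed.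

Lemma norm1N z : norm1 (- z) = norm1 z.
Proof. by rewrite /norm1 cReN cImN !normrN. Qed.

Lemma norm1_dist z u : `|norm1 z - norm1 u| <= norm1 (z - u).
Proof.
have h a b : norm1 a - norm1 b <= norm1 (a - b).
  by rewrite lerBlDr -{1}(subrK b a) norm1D.
rewrite ler_norml h andbT lerNl opprB -(norm1N (z - u)) opprB; exact: h.
Qed.

Lemma norm1M z u : norm1 (z * u) <= norm1 z * norm1 u.
Proof.
rewrite /norm1 cReM cImM.
apply: (le_trans (lerD (ler_normB _ _) (ler_normD _ _))).
by rewrite !normrM; lra.
Qed.

Lemma norm1_sum (I : Type) (s : seq I) (F : I -> R[i]) :
  norm1 (\sum_(i <- s) F i) <= \sum_(i <- s) norm1 (F i).
Proof.
elim: s => [|i s IH]; first by rewrite !big_nil norm1_0.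
by rewrite !big_cons (le_trans (norm1D _ _))// lerD.
Qed.

Lemma mulc_conjc z : z * conjc z = (Normc.normc z ^+ 2)%:C.
Proof.
case: z => a b; rewrite /Normc.normc sqr_sqrtr ?addr_ge0 ?sqr_ge0//.
by apply: eq_ReIm; rewrite ?(cReM, cImM)/=; ring.
Qed.

Lemma Re_sum (I : Type) (s : seq I) (F : I -> R[i]) :
  Re (\sum_(i <- s) F i) = \sum_(i <- s) Re (F i).
Proof. exact: (big_morph _ cReD). Qed.

(** The arithmetic-geometric inequality stands in for Cauchy-Schwarz when
    passing from [L^2] to [L^1] bounds. *)
Lemma norm1_le_amgm z (t : R) : 0 < t ->
  norm1 z <= t^-1 + t * Re (z * conjc z).
Proof.
move=> t0; rewrite cReM Re_conjc Im_conjc /norm1 mulrN opprK.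
rewrite -!expr2 -(real_normK (num_real (Re z))) -(real_normK (num_real (Im z))).
set a := `|_|; set b := `|_|.
have E : t^-1 + t * (a ^+ 2 + b ^+ 2) - (a + b) =
    t^-1 * ((t * a - 2^-1) ^+ 2 + (t * b - 2^-1) ^+ 2 + 2^-1).
  by field; rewrite gt_eqF.
rewrite -subr_ge0 E mulr_ge0 ?invr_ge0 ?(ltW t0)//.
by rewrite !addr_ge0 ?sqr_ge0 ?invr_ge0.
Qed.

End ComplexNumbers.

Section ComplexMean.
Context d (T : measurableType d) (R : realType) (P : probability T R).
Implicit Types f g : T -> R[i].

Definition cbounded f :=
  bounded_measurable (fun x => Re (f x)) /\ bounded_measurable (fun x => Im (f x)).

Definition cmean f : R[i] := (\int[P]_x Re (f x)) +i* (\int[P]_x Im (f x)).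

Lemma innerE f g : inner P f g = cmean (fun x => f x * conjc (g x)).
Proof. by []. Qed.

Lemma cbounded_cst c : cbounded (cst c).
Proof. by split; exact: bounded_measurable_cst. Qed.

Lemma cboundedD f g : cbounded f -> cbounded g -> cbounded (fun x => f x + g x).
Proof.
move=> [rf mf] [rg mg]; split.
  by under eq_fun do rewrite cReD; exact: bounded_measurableD.
by under eq_fun do rewrite cImD; exact: bounded_measurableD.
Qed.

Lemma cboundedM f g : cbounded f -> cbounded g -> cbounded (fun x => f x * g x).
Proof.
move=> [rf mf] [rg mg]; split.
  by under eq_fun do rewrite cReM; apply: bounded_measurableB; exact: bounded_measurableM.
by under eq_fun do rewrite cImM; apply: bounded_measurableD; exact: bounded_measurableM.
Qed.

Lemma cboundedZ c f : cbounded f -> cbounded (fun x => c * f x).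
Proof. by move=> bf; apply: cboundedM => //; exact: cbounded_cst. Qed.

Lemma cbounded_conj f : cbounded f -> cbounded (fun x => conjc (f x)).
Proof.
move=> [rf mf]; split; first by under eq_fun do rewrite Re_conjc.
by under eq_fun do rewrite Im_conjc; exact: bounded_measurableN.
Qed.

Lemma cbounded_sum (I : Type) (s : seq I) (F : I -> T -> R[i]) :
  (forall i, cbounded (F i)) -> cbounded (fun x => \sum_(i <- s) F i x).
Proof.
move=> bF; elim: s => [|i s IH].
  by under eq_fun do rewrite big_nil; exact: cbounded_cst.
by under eq_fun do rewrite big_cons; exact: cboundedD.
Qed.

Lemma cmeanD f g : cbounded f -> cbounded g ->
  cmean (fun x => f x + g x) = cmean f + cmean g.
Proof.
move=> [rf mf] [rg mg]; apply: eq_ReIm; rewrite ?(cReD, cImD)/= -meanD//.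
  by apply: eq_Rintegral => x _; rewrite cReD.
by apply: eq_Rintegral => x _; rewrite cImD.
Qed.

Lemma cmeanZ c f : cbounded f -> cmean (fun x => c * f x) = c * cmean f.
Proof.
move=> [rf mf]; apply: eq_ReIm; rewrite ?(cReM, cImM)/= -!meanZ//.
  rewrite -meanB//; last 2 first; try exact: bounded_measurableZ.
  by apply: eq_Rintegral => x _; rewrite cReM.
rewrite -meanD//; last 2 first; try exact: bounded_measurableZ.
by apply: eq_Rintegral => x _; rewrite cImM.
Qed.

Lemma cmean_sum (I : Type) (s : seq I) (F : I -> T -> R[i]) :
  (forall i, cbounded (F i)) ->
  cmean (fun x => \sum_(i <- s) F i x) = \sum_(i <- s) cmean (F i).
Proof.
move=> bF; elim: s => [|i s IH].
  rewrite big_nil; apply: eq_ReIm => /=.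
    by under eq_Rintegral do rewrite big_nil; rewrite mean_cst.
  by under eq_Rintegral do rewrite big_nil; rewrite mean_cst.
rewrite big_cons -IH -cmeanD//; last exact: cbounded_sum.
by congr cmean; apply/funext => x; rewrite big_cons.
Qed.

Lemma inner_sum (I J : Type) (s : seq I) (t : seq J) (a : I -> R[i]) (b : J -> R[i])
    (F : I -> T -> R[i]) (G : J -> T -> R[i]) :
  (forall i, cbounded (F i)) -> (forall j, cbounded (G j)) ->
  inner P (fun x => \sum_(i <- s) a i * F i x) (fun x => \sum_(j <- t) b j * G j x) =
  \sum_(i <- s) \sum_(j <- t) a i * conjc (b j) * inner P (F i) (G j).
Proof.
move=> bF bG; rewrite innerE.
transitivity (cmean (fun x => \sum_(i <- s) \sum_(j <- t)
    (a i * conjc (b j)) * (F i x * conjc (G j x)))).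
  congr cmean; apply/funext => x; rewrite conjc_sum mulr_suml.
  apply: eq_bigr => i _; rewrite mulr_sumr; apply: eq_bigr => j _.
  by rewrite conjcM mulrACA.
have bFG i j : cbounded (fun x => F i x * conjc (G j x)).
  by apply: cboundedM => //; exact: cbounded_conj.
rewrite cmean_sum; last first.
  by move=> i; apply: cbounded_sum => j; exact: cboundedZ.
apply: eq_bigr => i _; rewrite cmean_sum; last by move=> j; exact: cboundedZ.
by apply: eq_bigr => j _; rewrite cmeanZ.
Qed.

Lemma bounded_Lfun2 (f : T -> R) : bounded_measurable f -> f \in Lfun P 2%:E.
Proof.
move=> bf; rewrite inE; apply/andP; split; rewrite inE/=; first exact: bf.1.
rewrite /finite_norm unlock poweR_lty//.
have /integrableP[_] := bounded_measurable_integrable P (bounded_measurableM bf bf).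
apply: le_lt_trans; rewrite le_eqVlt; apply/orP; left; apply/eqP.
apply: eq_integral => x _ /=.
by rewrite powR_mulrn// expr2 -normrM.
Qed.

End ComplexMean.

(** * Characters of the torus *)

Section Trigonometry.
Variable R : realType.

Lemma cos_add_int (a : R) (m : int) : cos (a + 2 * pi * m%:~R) = cos a.
Proof.
have nat_case (b : R) (n : nat) : cos (b + 2 * pi * n%:R) = cos b.
  elim: n => [|n IH]; first by rewrite mulr0 addr0.
  rewrite -[RHS]IH -[n.+1%:R]natr1 mulrDr mulr1 addrA.
  by rewrite -[RHS]cosD2pi mulr_natl.
case: m => n; first exact: nat_case.
rewrite -[LHS](nat_case _ n.+1) -addrA -mulrDr NegzE mulrNz addNr.
by rewrite mulr0 addr0.
Qed.

Lemma sin_add_int (a : R) (m : int) : sin (a + 2 * pi * m%:~R) = sin a.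
Proof.
rewrite -cosBpihalf -[RHS]cosBpihalf -[RHS](cos_add_int _ m).
by congr cos; ring.
Qed.

Lemma cos_lipschitz (a b : R) : `|cos a - cos b| <= `|a - b|.
Proof.
wlog ba : a b / b <= a.
  move=> h; have [/h//|/ltW/h] := leP b a.
  by rewrite distrC (distrC a).
have dcos (x : R) : x \in `]b, a[ -> is_derive x 1 cos (- sin x).
  by move=> _; exact: is_derive_cos.
have [|c _ ->] := MVT_segment ba dcos.
  exact/continuous_subspaceT/continuous_cos.
by rewrite normrM normrN ler_piMl// sin_max.
Qed.

Lemma sin_lipschitz (a b : R) : `|sin a - sin b| <= `|a - b|.
Proof.
rewrite -!cosBpihalf (le_trans (cos_lipschitz _ _))//.
by rewrite opprB addrA subrK.
Qed.

End Trigonometry.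

Section Characters.
Variable R : realType.
Local Notation U := (uniform_prob (@ltr01 R)).
Local Notation mu := (torus_measure R).

Definition phase d (k : 'I_d -> int) (x : torus_point R d) : R :=
  2 * pi * \sum_(i < d) (k i)%:~R * tnth x i.

Lemma trig_funE d (n : d.-tuple int) (x : torus_point R d) :
  trig_fun n x = cos (phase (tnth n) x) +i* sin (phase (tnth n) x).
Proof. by []. Qed.

Lemma measurable_phase d (k : 'I_d -> int) : measurable_fun setT (phase k).
Proof.
apply: measurable_funM; first exact: measurable_cst.
apply: measurable_sum => i; apply: measurable_funM; first exact: measurable_cst.
exact: (@measurable_tnth _ (measurableTypeR R)).
Qed.

Lemma bounded_cos d (k : 'I_d -> int) c :
  bounded_measurable (fun x => cos (phase k x + c)).
Proof.
split; last by exists 1 => x; exact: cos_max.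
apply: measurableT_comp.
  by apply: continuous_measurable_fun; exact: continuous_cos.
by apply: measurable_funD; [exact: measurable_phase|exact: measurable_cst].
Qed.

Lemma bounded_sin d (k : 'I_d -> int) :
  bounded_measurable (fun x => sin (phase k x)).
Proof.
by under eq_fun do rewrite -cosBpihalf; exact: bounded_cos.
Qed.

Lemma cbounded_trig d (n : d.-tuple int) : cbounded (trig_fun (R := R) n).
Proof.
split; last exact: bounded_sin.
rewrite (_ : (fun _ => _) = (fun x => cos (phase (tnth n) x + 0))); first exact: bounded_cos.
by apply/funext => x; rewrite addr0.
Qed.

Lemma mean_cos_interval (n : int) (c : R) :
  \int[U]_y cos (2 * pi * n%:~R * y + c) = if n == 0 then cos c else 0.
Proof.
case: eqP => [->|/eqP n0].
  under eq_Rintegral do rewrite mulr0 mul0r add0r.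
  by rewrite mean_cst.
have w0 : 2 * pi * n%:~R != 0 :> R.
  by rewrite !mulf_neq0// ?intr_eq0// gt_eqF// pi_gt0.
set w := 2 * pi * _ in w0 *.
have caff : continuous (fun y : R => w * y + c).
  by move=> y; apply: cvgD; [apply: cvgM; [exact: cvg_cst|exact: cvg_id]|exact: cvg_cst].
have ch : continuous (fun y : R => cos (w * y + c)).
  by move=> y; apply: continuous_comp; [exact: caff|exact: continuous_cos].
have bh : bounded_measurable (fun y : R => cos (w * y + c)).
  by split; [exact: continuous_measurable_fun|exists 1 => y; exact: cos_max].
have dh (y : R) : 0 <= y <= 1 ->
    is_derive y 1 (fun y => w^-1 * sin (w * y + c)) (cos (w * y + c)).
  move=> _.
  have d1 : is_derive y 1 (fun y : R => w * y + c) w.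
    by apply: is_derive_eq; rewrite /GRing.scale/= ?mulr1 ?addr0.
  have d2 : is_derive y 1 (fun y => sin (w * y + c)) (cos (w * y + c) * w).
    exact: (@is_derive1_comp R sin (fun y => w * y + c)).
  by apply: is_derive_eq; rewrite /GRing.scale/= mulrCA mulVf ?mulr1.
rewrite (mean_FTC2 ch bh dh) -mulrBr mulr1 mulr0 add0r (addrC w) [in X in sin X - _]/w sin_add_int subrr.
by rewrite mulr0.
Qed.

Lemma phase_cons d (k : 'I_d.+1 -> int) (y : R) (x : torus_point R d) :
  phase k (cons_point (y, x)) =
  2 * pi * (k ord0)%:~R * y + phase (fun i => k (lift ord0 i)) x.
Proof.
rewrite /phase big_ord_recl mulrDr tnth_cons0 mulrA; congr (_ + _ * _).
by apply: eq_bigr => i _; rewrite tnth_consS.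
Qed.

(** The phase [c] is there for the induction on the dimension; with
    [c = - pi / 2] the same formula also covers the sine. *)
Lemma mean_cos d (k : 'I_d -> int) (c : R) :
  \int[mu d]_x cos (phase k x + c) = if [forall i, k i == 0] then cos c else 0.
Proof.
elim: d k c => [|d IH] k c.
  rewrite mean_torus0; last exact: bounded_cos.
  rewrite /phase big_ord0 mulr0 add0r.
  by case: ifPn => // /forallPn[[]].
rewrite mean_torusS; last exact: bounded_cos.
transitivity (\int[U]_y (if [forall i, k (lift ord0 i) == 0]
    then cos (2 * pi * (k ord0)%:~R * y + c) else 0)).
  apply: eq_Rintegral => y _; rewrite -IH; apply: eq_Rintegral => x _.
  by rewrite phase_cons addrAC addrC.
case: (boolP [forall i, k (lift ord0 i) == 0]) => [/forallP k0|nk].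
  rewrite mean_cos_interval; congr (if _ then _ else _); apply/idP/forallP => [kk i|//].
  by case: (unliftP ord0 i) => [j ->|->].
rewrite mean_cst; case: ifPn => // /forallP kk.
by case/negP: nk; apply/forallP => i.
Qed.

Lemma inner_trig d (n m : d.-tuple int) :
  inner (mu d) (trig_fun n) (trig_fun m) = (n == m)%:R.
Proof.
pose k i := tnth n i - tnth m i.
have kE x : phase k x = phase (tnth n) x - phase (tnth m) x.
  rewrite /phase -mulrBr -sumrB; congr (_ * _); apply: eq_bigr => i _.
  by rewrite intrB mulrBl.
have nm : (n == m) = [forall i, k i == 0].
  apply/eqP/forallP => [nm i|h]; first by rewrite /k nm subrr.
  by apply: eq_from_tnth => i; apply/eqP; rewrite -subr_eq0 h.
rewrite innerE; apply: eq_ReIm => /=.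
  transitivity (\int[mu d]_x cos (phase k x + 0)).
    by apply: eq_Rintegral => x _; rewrite addr0 kE cosB mulrN opprK.
  by rewrite mean_cos -nm cos0; case: eqP.
transitivity (\int[mu d]_x cos (phase k x - pi / 2)).
  by apply: eq_Rintegral => x _; rewrite cosBpihalf kE sinB addrC mulrN.
rewrite mean_cos -nm cosN cos_pihalf; by case: eqP.
Qed.

End Characters.

(** * Frequencies and observables along the curve *)

Section Frequencies.
Variables (R : realType) (d : nat).

Definition freq (Q : nat) (n : d.-tuple int) : int :=
  \sum_(i < d) tnth n i * Q%:Z ^+ i.+1.

Lemma digits_eq0 (m : nat) (k : 'I_m -> int) (Q : nat) :
  (forall i, `|k i| < Q%:Z) -> \sum_(i < m) k i * Q%:Z ^+ i = 0 ->
  forall i, k i = 0.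
Proof.
elim: m k => [|m IH] k kQ; first by move=> _ [].
rewrite big_ord_recl expr0 mulr1.
have -> : \sum_(i < m) k (lift ord0 i) * Q%:Z ^+ lift ord0 i =
    Q%:Z * \sum_(i < m) k (lift ord0 i) * Q%:Z ^+ i.
  rewrite mulr_sumr; apply: eq_bigr => i _.
  by rewrite lift0 exprS mulrCA.
set S := \sum_(i < m) _ => kS.
have Q0 : 0 < Q%:Z by apply: le_lt_trans (kQ ord0).
have S0 : S = 0.
  apply/eqP/negPn/negP => Sn0.
  have S1 : 1 <= `|S| by rewrite -gtz0_ge1 normr_gt0.
  have := kQ ord0; rewrite ltNge => /negP; apply.
  have -> : k ord0 = - (Q%:Z * S) by apply/eqP; rewrite -addr_eq0 kS.
  by rewrite normrN normrM (gtr0_norm Q0) ler_peMr// ltW.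
have k0 : k ord0 = 0 by move: kS; rewrite S0 mulr0 addr0.
move=> i; case: (unliftP ord0 i) => [j ->|->//].
exact: (IH (fun i => k (lift ord0 i)) (fun i => kQ _) S0).
Qed.

Lemma freqE Q n : freq Q n = Q%:Z * \sum_(i < d) tnth n i * Q%:Z ^+ i.
Proof.
by rewrite mulr_sumr; apply: eq_bigr => i _; rewrite exprS mulrCA.
Qed.

(** Uniqueness of the expansion in base [Q] with digits small compared to [Q]. *)
Lemma freq_inj (Q : nat) (B : nat) (n m : d.-tuple int) :
  (forall i, `|tnth n i| <= B%:Z) -> (forall i, `|tnth m i| <= B%:Z) ->
  (2 * B < Q)%N -> freq Q n = freq Q m -> n = m.
Proof.
move=> nB mB BQ; rewrite !freqE => /eqP; rewrite -subr_eq0 -mulrBr mulf_eq0.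
have Q0 : (Q%:Z == 0) = false by apply/negbTE; rewrite -lt0n; case: Q BQ.
rewrite Q0 orFb -sumrB => /eqP S0.
apply: eq_from_tnth => i; apply/eqP; rewrite -subr_eq0; apply/eqP.
apply: (@digits_eq0 _ (fun i => tnth n i - tnth m i) Q) => [j|].
  rewrite (le_lt_trans (ler_normB _ _))// (le_lt_trans (lerD (nB j) (mB j)))//.
  by rewrite -PoszD ltz_nat addnn -mul2n.
by rewrite -[RHS]S0; apply: eq_bigr => j _; rewrite mulrBl.
Qed.

(** Transferred frequencies are multiples of [Q]. Hence, apart from 0, those of
    a block lie beyond all those of the blocks with much smaller [Q]. *)
Lemma freq_eq0 Q n : `|freq Q n| < Q%:Z -> freq Q n = 0.
Proof.
rewrite freqE => h; set S := \sum_(i < d) _ in h *.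
have Q0 : 0 < Q%:Z by apply: le_lt_trans h.
suff -> : S = 0 by rewrite mulr0.
apply/eqP/negPn/negP => Sn0.
have S1 : 1 <= `|S| by rewrite -gtz0_ge1 normr_gt0.
by move: h; rewrite normrM (gtr0_norm Q0) ltNge ler_peMr// ltW.
Qed.

Definition point1 (y : R) : torus_point R 1 := cons_point (y, [tuple]).

Lemma point1_tnth (x : torus_point R 1) : x = point1 (tnth x ord0).
Proof. by apply: eq_from_tnth => i; rewrite ord1. Qed.

Lemma tnth_curve Q y i : tnth (curve d Q y) i = Q%:R ^+ i.+1 * y :> R.
Proof.
elim: d y i => [|d' IH] y i; first by case: i.
rewrite /=; case: (unliftP ord0 i) => [j ->|->].
  by rewrite tnth_consS IH lift0 [in RHS]exprS mulrCA mulrA.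
by rewrite tnth_cons0 expr1.
Qed.

Lemma trig_curve Q (n : d.-tuple int) (y : R) :
  trig_fun n (curve d Q y) = trig_fun [tuple freq Q n] (point1 y).
Proof.
rewrite !trig_funE.
suff -> : phase (tnth n) (curve d Q y) = phase (tnth [tuple freq Q n]) (point1 y).
  by [].
rewrite /phase big_ord1 tnth_cons0; congr (_ * _).
rewrite /freq rmorph_sum/= mulr_suml; apply: eq_bigr => i _.
by rewrite tnth_curve rmorphM/= rmorphXn/= mulrA.
Qed.

End Frequencies.

Section Tame.
Variable R : realType.

(** The properties of trigonometric polynomials that the transfer uses. *)
Record tame d (f : torus_point R d -> R[i]) : Prop := Tame {
  tame_bounded : cbounded f ;
  tame_lipschitz : exists2 L, 0 <= L & forall x x', norm1 (f x - f x') <= L * dist1 x x' ;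
  tame_periodic : forall x x', eq_mod1 x x' -> f x = f x' }.

Lemma tame_cst d c : tame (cst c : torus_point R d -> R[i]).
Proof.
split => //; first exact: cbounded_cst.
by exists 0 => // x x'; rewrite subrr norm1_0 mul0r.
Qed.

Lemma tameD d (f g : torus_point R d -> R[i]) : tame f -> tame g ->
  tame (fun x => f x + g x).
Proof.
move=> [bf [L L0 fL] pf] [bg [M M0 gM] pg]; split.
- exact: cboundedD.
- exists (L + M); first exact: addr_ge0.
  move=> x x'; rewrite opprD addrACA (le_trans (norm1D _ _))// mulrDl.
  exact: lerD.
- by move=> x x' xx'; rewrite (pf _ _ xx') (pg _ _ xx').
Qed.

Lemma tameZ d c (f : torus_point R d -> R[i]) : tame f -> tame (fun x => c * f x).
Proof.
move=> [bf [L L0 fL] pf]; split.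
- exact: cboundedZ.
- exists (norm1 c * L); first by rewrite mulr_ge0// norm1_ge0.
  move=> x x'; rewrite -mulrBr (le_trans (norm1M _ _))// -mulrA.
  by rewrite ler_wpM2l// norm1_ge0.
- by move=> x x' xx'; rewrite (pf _ _ xx').
Qed.

Lemma tame_sum d (I : Type) (s : seq I) (F : I -> torus_point R d -> R[i]) :
  (forall i, tame (F i)) -> tame (fun x => \sum_(i <- s) F i x).
Proof.
move=> tF; elim: s => [|i s IH].
  rewrite (_ : (fun x => _) = cst 0); first exact: tame_cst.
  by apply/funext => x; rewrite big_nil.
rewrite (_ : (fun x => _) = (fun x => F i x + \sum_(j <- s) F j x)).
  exact: tameD.
by apply/funext => x; rewrite big_cons.
Qed.

Lemma phase_lipschitz d (k : 'I_d -> int) : exists2 L, 0 <= L &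
  forall x x' : torus_point R d, `|phase k x - phase k x'| <= L * dist1 x x'.
Proof.
exists (2 * pi * \sum_(i < d) `|(k i)%:~R|).
  by rewrite mulr_ge0// ?sumr_ge0// mulr_ge0// pi_ge0.
move=> x x'; rewrite /phase -mulrBr normrM ger0_norm; last by rewrite mulr_ge0// pi_ge0.
rewrite -[leRHS]mulrA ler_wpM2l//; first by rewrite mulr_ge0// pi_ge0.
rewrite -sumrB (le_trans (ler_norm_sum _ _ _))// mulr_suml.
apply: ler_sum => i _; rewrite -mulrBr normrM ler_wpM2l//.
by rewrite /dist1 (bigD1 i)//= lerDl sumr_ge0.
Qed.

Lemma tame_trig d (n : d.-tuple int) : tame (trig_fun (R := R) n).
Proof.
split; first exact: cbounded_trig.
- have [L L0 kL] := phase_lipschitz (tnth n).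
  exists (2 * L); first exact: mulr_ge0.
  move=> x x'; rewrite /norm1 cReD cImD cReN cImN -mulrA mulr_natl mulr2n.
  by rewrite lerD// (le_trans _ (kL x x'))// ?cos_lipschitz// sin_lipschitz.
- move=> x x' xx'; rewrite !trig_funE.
  have [m xm] := choice xx'.
  have -> : phase (tnth n) x =
      phase (tnth n) x' + 2 * pi * (\sum_(i < d) tnth n i * m i)%:~R.
    rewrite /phase -mulrDr rmorph_sum/= -big_split/=; congr (_ * _).
    by apply: eq_bigr => i _; rewrite xm rmorphM mulrDr.
  by rewrite cos_add_int sin_add_int.
Qed.

(** A Lipschitz substitute for the indicator of [t <= e]: it is 1 there and
    vanishes for [t >= 2 e]. *)
Definition cutoff (e t : R) : R := Num.max 0 (Num.min 1 (2 - t / e)).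

Lemma cutoff01 e t : 0 <= cutoff e t <= 1.
Proof. by rewrite /cutoff le_max lexx/= ge_max ler01 ge_min lexx. Qed.

Lemma cutoff_small e t : 0 < e -> t <= e -> cutoff e t = 1.
Proof.
move=> e0 te; rewrite /cutoff.
have : t / e <= 1 by rewrite ler_pdivrMr// mul1r.
by move=> ?; rewrite min_l ?max_r//; lra.
Qed.

Lemma cutoff_gt0 e t : 0 < e -> 0 < cutoff e t -> t < 2 * e.
Proof.
move=> e0; rewrite /cutoff lt_max ltxx/= lt_min ltr01/= subr_gt0.
by rewrite ltr_pdivrMr.
Qed.

Lemma cutoff_lipschitz e t t' : 0 < e -> `|cutoff e t - cutoff e t'| <= e^-1 * `|t - t'|.
Proof.
move=> e0.
have clamp_lip (a b : R) : `|Num.max 0 (Num.min 1 a) - Num.max 0 (Num.min 1 b)| <= `|a - b|.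
  rewrite /Num.max /Num.min; do ?case: ifPn; rewrite -?leNgt;
    move=> *; rewrite ?subrr ?normr0 ?normr_ge0//;
    rewrite ler_norml; have := ler_norm (a - b); have := ler_norm (b - a);
    rewrite distrC; lra.
apply: (le_trans (clamp_lip _ _)).
rewrite (_ : _ - _ = e^-1 * (t' - t)); last by ring.
by rewrite normrM distrC ger0_norm// invr_ge0 ltW.
Qed.

Lemma lipschitz_periodic_cutoff d (f : torus_point R d -> R[i]) e : 0 < e -> tame f ->
  exists L, lipschitz_periodic L (fun x => cutoff e (norm1 (f x))).
Proof.
move=> e0 [bf [L L0 fL] pf]; exists (e^-1 * L); split.
- apply: measurable_maxr; first exact: measurable_cst.
  apply: measurable_minr; first exact: measurable_cst.
  apply: measurable_funB; first exact: measurable_cst.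
  apply: measurable_funM; last exact: measurable_cst.
  by apply: measurable_funD; apply: measurableT_comp => //; [exact: bf.1.1|exact: bf.2.1].
- by move=> x; exact: cutoff01.
- move=> x x'; rewrite (le_trans (cutoff_lipschitz _ _ e0))// -mulrA.
  rewrite ler_wpM2l ?invr_ge0 ?(ltW e0)//.
  exact: le_trans (norm1_dist _ _) (fL _ _).
- by move=> x x' xx'; rewrite (pf _ _ xx').
Qed.

End Tame.

(** * Convergence of complex series by blocks *)

Section ComplexLimits.
Variable R : realType.

Lemma real_cvg_of_cauchy (v : nat -> R) :
  (forall e, 0 < e -> exists S K, forall n, (K <= n)%N -> `|v n - S| <= e) ->
  cvgn v.
Proof.
move=> h; apply: cauchy_cvg; apply: cauchy_exP => e e0.
have [S [K SK]] := h _ (divr_gt0 e0 (ltr0n R 2)); exists S.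
exists K => //= n /= Kn; rewrite /ball/= distrC.
by rewrite (le_lt_trans (SK n Kn))// ltr_pdivrMr// ltr_pMr// ltr1n.
Qed.

Lemma real_cauchy_of_cvg (v : nat -> R) : cvgn v ->
  forall e, 0 < e -> exists K, forall n, (K <= n)%N -> `|v n - limn v| <= e.
Proof.
move=> cv e e0.
have /cvgrPdist_le/(_ e e0)[K _ h] := cv.
by exists K => n Kn; rewrite distrC; exact: h.
Qed.

Lemma normc_le_norm1 (z : R[i]) : Normc.normc z <= norm1 z.
Proof.
case: z => a b; rewrite /norm1/=.
rewrite -[leRHS]ger0_norm ?addr_ge0// -sqrtr_sqr ler_wsqrtr// sqrrD.
rewrite !real_normK ?num_real// addrAC lerDl.
by rewrite mulrn_wge0// mulr_ge0.
Qed.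

Lemma norm1_le_normc (z : R[i]) : norm1 z <= 2 * Normc.normc z.
Proof.
case: z => a b; rewrite /norm1/= mulr_natl mulr2n.
by apply: lerD; rewrite -sqrtr_sqr ler_wsqrtr// ?lerDl ?lerDr sqr_ge0.
Qed.

Lemma normc_normE (z : R[i]) : `|z| = (Normc.normc z)%:C.
Proof. by case: z => a b; rewrite normc_def. Qed.

(** Completeness of the complex plane, from that of the real line through real
    and imaginary parts. *)
Lemma complex_cvg_of_cauchy (v : nat -> R[i]) :
  (forall e, 0 < e -> exists S K, forall n, (K <= n)%N -> norm1 (v n - S) <= e) ->
  cvgn (v : nat -> R[i]^o).
Proof.
move=> h.
have cre : cvgn (fun n => Re (v n)).
  apply: real_cvg_of_cauchy => e /h[S [K SK]]; exists (Re S), K => n /SK.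
  by apply: le_trans; rewrite -cReN -cReD lerDl.
have cim : cvgn (fun n => Im (v n)).
  apply: real_cvg_of_cauchy => e /h[S [K SK]]; exists (Im S), K => n /SK.
  by apply: le_trans; rewrite -cImN -cImD lerDr.
apply/cvg_ex; exists (limn (fun n => Re (v n)) +i* limn (fun n => Im (v n))).
apply/cvgrPdist_le => e e0.
have : 0 < e by [].
rewrite ltcE/= => /andP[/eqP ime ree].
have e2 : 0 < Re e / 2 by rewrite divr_gt0.
have [K1 h1] := real_cauchy_of_cvg cre e2.
have [K2 h2] := real_cauchy_of_cvg cim e2.
exists (maxn K1 K2) => //= n /=; rewrite geq_max => /andP[n1 n2].
rewrite normc_normE lecE/= ime eqxx/=.
apply: (le_trans (normc_le_norm1 _)).
rewrite /norm1 cReD cImD cReN cImN/= (distrC _ (Re _)) (distrC _ (Im _)).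
rewrite [leRHS]splitr.
by apply: lerD; [exact: h1|exact: h2].
Qed.

Lemma complex_cauchy_of_cvg (v : nat -> R[i]) : cvgn (v : nat -> R[i]^o) ->
  forall e, 0 < e -> exists K, forall m n, (K <= m)%N -> (K <= n)%N ->
    norm1 (v m - v n) <= e.
Proof.
move=> cv e e0.
pose l : R[i] := limn (v : nat -> R[i]^o).
have e4 : 0 < (e / 4)%:C :> R[i] by rewrite ltcE/= eqxx divr_gt0.
have /cvgrPdist_le/(_ _ e4)[K _ h] := cv.
have hK n : (K <= n)%N -> norm1 (v n - l) <= e / 2.
  move=> Kn; have := h n Kn; rewrite -/l normc_normE lecE/= eqxx/= => hn.
  rewrite -norm1N opprB (le_trans (norm1_le_normc _))//.
  by move: hn; rewrite /l; lra.
exists K => m n Km Kn.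
rewrite -[v m](subrK l) -addrA [leRHS]splitr.
apply: (le_trans (norm1D _ _)); apply: lerD; first exact: hK.
by rewrite -norm1N opprB; exact: hK.
Qed.

End ComplexLimits.

Section Blocks.
Variable R : realType.
Variable N : nat -> nat.
Hypotheses (N0 : N 0%N = 0%N) (NS : forall j, (N j < N j.+1)%N).

Lemma block_mono i j : (i <= j)%N -> (N i <= N j)%N.
Proof.
elim: j => [|j IH]; first by rewrite leqn0 => /eqP ->.
rewrite leq_eqVlt => /predU1P[->//|]; rewrite ltnS => /IH h.
exact: leq_trans h (ltnW (NS j)).
Qed.

Lemma block_exists n : exists j, (N j <= n < N j.+1)%N.
Proof.
elim: n => [|n [j /andP[h1 h2]]].
  by exists 0%N; rewrite N0 /= (leq_trans _ (NS 0%N)).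
have [h|h] := ltnP n.+1 (N j.+1); first by exists j; rewrite h leqW.
by exists j.+1; rewrite h /= (leq_ltn_trans h2 (NS j.+1)).
Qed.

Lemma block_le i j n : (N i <= n)%N -> (n < N j.+1)%N -> (i <= j)%N.
Proof.
move=> h1 h2; rewrite leqNgt; apply/negP => /block_mono h.
by have := leq_trans h2 (leq_trans h h1); rewrite ltnn.
Qed.

Lemma block_unique i j n : (N i <= n < N i.+1)%N -> (N j <= n < N j.+1)%N -> i = j.
Proof.
move=> /andP[h1 h2] /andP[h3 h4]; apply/eqP; rewrite eqn_leq.
by rewrite (block_le h1 h4) (block_le h3 h2).
Qed.

Lemma sum_blocks (V : zmodType) (u : nat -> V) i j : (i <= j)%N ->
  \sum_(N i <= k < N j) u k = \sum_(i <= p < j) \sum_(N p <= k < N p.+1) u k.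
Proof.
elim: j => [|j IH]; first by rewrite leqn0 => /eqP ->; rewrite !big_geq.
rewrite leq_eqVlt => /predU1P[->|]; first by rewrite !big_geq.
rewrite ltnS => ij; rewrite big_nat_recr//= -IH// (@big_cat_nat _ _ _ (N j))//.
  exact: block_mono.
exact: ltnW.
Qed.

(** Any partial sum consists of complete blocks and of an initial part of one
    more block. *)
Lemma cvg_series_blocks (u : nat -> R[i]) :
  cvgn (series (fun j => norm1 (\sum_(N j <= i < N j.+1) u i))) ->
  (forall e, 0 < e -> exists J, forall j k, (J <= j)%N -> (N j <= k < N j.+1)%N ->
    norm1 (\sum_(N j <= i < k.+1) u i) <= e) ->
  cvgn (series u : nat -> R[i]^o).
Proof.
move=> cD cB; apply: complex_cvg_of_cauchy => e e0.
have e2 : 0 < e / 2 by rewrite divr_gt0.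
have e4 : 0 < e / 2 / 2 by rewrite divr_gt0.
have [J1 h1] := real_cauchy_of_cvg cD e4.
have [J2 h2] := cB _ e2.
pose J := maxn J1 J2.
exists (series u (N J)), (N J).+1 => -[//|n]; rewrite ltnS => Jn.
have [j jn] := block_exists n; have /andP[jn1 jn2] := jn.
have Jj : (J <= j)%N := block_le Jn jn2.
have -> : series u n.+1 - series u (N J) =
    \sum_(J <= p < j) \sum_(N p <= k < N p.+1) u k + \sum_(N j <= i < n.+1) u i.
  rewrite sub_series_geq ?leqW// -sum_blocks// -big_cat_nat//.
  exact: block_mono.
  exact: leqW.
rewrite (le_trans (norm1D _ _))// [leRHS]splitr lerD//; last first.
  by apply: h2 => //; rewrite (leq_trans _ Jj)// leq_maxr.
apply: (le_trans (norm1_sum _ _)).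
rewrite -(sub_series_geq (fun j => norm1 (\sum_(N j <= i < N j.+1) u i)))//.
rewrite (le_trans (ler_norm _))//.
set v := series _; rewrite -(subrK (limn v) (v j)) -addrA [leRHS]splitr.
rewrite (le_trans (ler_normD _ _))// lerD//.
  by apply: h1; rewrite (leq_trans _ Jj)// leq_maxl.
by rewrite distrC; apply: h1; rewrite leq_maxl.
Qed.

Lemma small_blocks_of_cvg (u : nat -> R[i]) :
  cvgn (series u : nat -> R[i]^o) ->
  forall e, 0 < e -> exists J, forall j k, (J <= j)%N -> (N j <= k < N j.+1)%N ->
    norm1 (\sum_(N j <= i < k.+1) u i) <= e.
Proof.
move=> cu e e0; have [K h] := complex_cauchy_of_cvg cu e0.
have geN j : (j <= N j)%N.
  by elim: j => // j IH; apply: leq_ltn_trans IH (NS j).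
exists K => j k Kj /andP[jk _].
have KN : (K <= N j)%N := leq_trans Kj (geN j).
rewrite -sub_series_geq ?leqW//; apply: h => //.
by rewrite leqW// (leq_trans KN).
Qed.

End Blocks.

(** * Absolute summability of the block sums *)

Section BlockSums.
Variable R : realType.

Lemma geometric_sum_le (m J : nat) :
  \sum_(m <= j < J) (2^-1 : R) ^+ j <= 2 * (2^-1) ^+ m.
Proof.
have [mJ|/ltnW mJ] := leqP m J; last first.
  by rewrite big_geq// mulr_ge0// exprn_ge0// invr_ge0.
suff -> : \sum_(m <= j < J) (2^-1 : R) ^+ j = 2 * (2^-1) ^+ m - 2 * (2^-1) ^+ J.
  by rewrite lerBlDr lerDl mulr_ge0// exprn_ge0// invr_ge0.
elim: J mJ => [|J IH]; first by rewrite leqn0 => /eqP ->; rewrite big_geq// subrr.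
rewrite leq_eqVlt => /predU1P[->|]; first by rewrite big_geq// subrr.
by rewrite ltnS => mJ; rewrite big_nat_recr//= IH// exprS; lra.
Qed.

Lemma weight_blocks (w : nat -> R) : weight_sequence w -> exists N : nat -> nat,
  [/\ N 0%N = 0%N, forall j, (N j < N j.+1)%N &
      forall j n, (N j <= n)%N -> 4 ^+ j * w 1%N <= w n.+1].
Proof.
move=> [w0 wm woo].
have ex j : exists K, forall n, (K <= n)%N -> 4 ^+ j * w 1%N <= w n.+1.
  have /cvgryPge/(_ (4 ^+ j * w 1%N))[K _ h] := woo.
  by exists K => n Kn; apply: h => /=; exact: leqW.
have [K hK] := choice ex.
pose N := fix N j := if j is j'.+1 then maxn (N j').+1 (K j'.+1) else 0%N.
exists N; split => // [j|[|j] n jn]; first by rewrite /= leq_maxl.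
  by rewrite expr0 mul1r; apply: wm.
by apply: hK; move: jn; rewrite /= geq_max => /andP[].
Qed.

Context dp (T : measurableType dp) (P : probability T R).

Lemma bounded_measurable_norm1 (f : T -> R[i]) : cbounded f ->
  bounded_measurable (fun x => norm1 (f x)).
Proof.
have babs (g : T -> R) : bounded_measurable g -> bounded_measurable (fun x => `|g x|).
  move=> [mg [M gM]]; split; first exact: measurableT_comp.
  by exists M => x; rewrite normr_id.
by move=> [bre bim]; apply: bounded_measurableD; exact: babs.
Qed.

Lemma mean_sqr_sum (p : nat -> T -> R[i]) (a : nat -> R[i]) (s : seq nat) :
  uniq s -> (forall n, cbounded (p n)) ->
  (forall m n, inner P (p m) (p n) = (m == n)%:R) ->
  \int[P]_x Re ((\sum_(i <- s) a i * p i x) * conjc (\sum_(i <- s) a i * p i x)) =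
  \sum_(i <- s) Normc.normc (a i) ^+ 2.
Proof.
move=> us bp op.
transitivity (Re (inner P (fun x => \sum_(i <- s) a i * p i x)
                          (fun x => \sum_(i <- s) a i * p i x))); first by [].
rewrite inner_sum// Re_sum; apply: eq_big_seq => i si.
rewrite (bigD1_seq i)//= big1 ?addr0; last first.
  by move=> j ji; rewrite op eq_sym (negbTE ji) mulr0.
by rewrite op eqxx mulr1 mulc_conjc.
Qed.

Lemma weighted_sum_bound (w : nat -> R) (a : nat -> R[i]) : weight_sequence w ->
  (\sum_(0 <= k <oo) ((Normc.normc (a k)) ^+ 2 * w k.+1)%:E < +oo)%E ->
  exists E, forall m n, \sum_(m <= k < n) (Normc.normc (a k)) ^+ 2 * w k.+1 <= E.
Proof.
move=> [w0 _ _] aw.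
have u0 k : 0 <= (Normc.normc (a k)) ^+ 2 * w k.+1.
  by rewrite mulr_ge0 ?sqr_ge0// ltW// w0.
exists (fine (\sum_(0 <= k <oo) ((Normc.normc (a k)) ^+ 2 * w k.+1)%:E)%E) => m n.
rewrite -lee_fin fineK; last first.
  by rewrite ge0_fin_numE// nneseries_ge0// => k _ _; rewrite lee_fin.
apply: (@le_trans _ _ (\sum_(0 <= k < n) (Normc.normc (a k) ^+ 2 * w k.+1)%:E)%E); last first.
  by apply: nneseries_lim_ge => k _ _; rewrite lee_fin.
rewrite sumEFin lee_fin.
have [mn|nm] := leqP m n; last by rewrite big_geq ?(ltnW nm)// sumr_ge0.
by rewrite [leRHS](@big_cat_nat _ _ _ m)//= lerDr sumr_ge0.
Qed.

(** In the [j]-th block the weight gains a factor [4^j], so the squared norm of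
    the block sum is [O(4^-j)]; the arithmetic-geometric inequality with
    parameter [2^j] then bounds its [L^1] norm by [O(2^-j)]. *)
Lemma block_sums_summable (p : nat -> T -> R[i]) (a : nat -> R[i]) (w : nat -> R)
    (N : nat -> nat) :
  weight_sequence w -> (forall j n, (N j <= n)%N -> 4 ^+ j * w 1%N <= w n.+1) ->
  (\sum_(0 <= k <oo) ((Normc.normc (a k)) ^+ 2 * w k.+1)%:E < +oo)%E ->
  (forall n, cbounded (p n)) ->
  (forall m n, inner P (p m) (p n) = (m == n)%:R) ->
  {ae P, forall x,
    cvgn (series (fun j => norm1 (\sum_(N j <= i < N j.+1) a i * p i x)))}.
Proof.
move=> ww wN aw bp op.
have w1 : 0 < w 1%N by case: ww => + _ _; apply.
have [E hE] := weighted_sum_bound ww aw.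
have E0 : 0 <= E by have := hE 0 0; rewrite big_geq.
pose D j x := \sum_(N j <= i < N j.+1) a i * p i x.
have bD j : cbounded (D j).
  by apply: cbounded_sum => i; exact: cboundedZ.
have bDD j : cbounded (fun x => D j x * conjc (D j x)).
  by apply: cboundedM => //; exact: cbounded_conj.
pose c := 1 + E / w 1%N.
apply: (@ae_summable _ _ _ P (fun j x => norm1 (D j x)) (c * 2)).
- by move=> j; exact: bounded_measurable_norm1.
- by move=> j x; exact: norm1_ge0.
move=> n; apply: (@le_trans _ _ (\sum_(0 <= j < n) c * (2^-1) ^+ j)); last first.
  rewrite -mulr_sumr ler_wpM2l//; first by rewrite addr_ge0// divr_ge0// ltW.
  by rewrite (le_trans (geometric_sum_le _ _))// expr0 mulr1.
rewrite big_mkord; apply: ler_sum => j _.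
have t0 : 0 < 2 ^+ j :> R by rewrite exprn_gt0.
pose s := \sum_(N j <= i < N j.+1) Normc.normc (a i) ^+ 2.
have sle : s * (4 ^+ j * w 1%N) <= E.
  apply: le_trans (hE (N j) (N j.+1)).
  rewrite mulr_suml; apply: ler_sum_nat => i /andP[ij _].
  by rewrite ler_wpM2l ?sqr_ge0// wN.
have mD : \int[P]_x Re (D j x * conjc (D j x)) = s.
  by apply: mean_sqr_sum => //; exact: iota_uniq.
apply: (@le_trans _ _ (\int[P]_x ((2 ^+ j)^-1 + 2 ^+ j * Re (D j x * conjc (D j x))))).
  apply: le_mean => [||x].
  - exact: bounded_measurable_norm1.
  - by apply: bounded_measurableD; [exact: bounded_measurable_cst|apply: bounded_measurableZ; exact: (bDD j).1].
  - exact: norm1_le_amgm.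
rewrite meanD; last 2 first.
- exact: bounded_measurable_cst.
- by apply: bounded_measurableZ; exact: (bDD j).1.
rewrite mean_cst meanZ; last exact: (bDD j).1.
rewrite mD /c mulrDl mul1r exprVn lerD2l.
rewrite ler_pdivlMr// ler_pdivlMr// (le_trans _ sle)//.
rewrite (_ : 4 = 2 * 2 :> R); last by ring.
by rewrite exprMn le_eqVlt; apply/orP; left; apply/eqP; ring.
Qed.

End BlockSums.

(** * Asymptotic independence of transferred blocks *)

Section LipschitzTransfer.
Variable R : realType.

Lemma measurable_torus dT (T : measurableType dT) d (f : T -> torus_point R d) :
  (forall i, measurable_fun setT (fun x => tnth (f x) i)) -> measurable_fun setT f.
Proof. by move=> h; apply/measurable_fun_tnthP. Qed.

Lemma measurable_coord d (i : 'I_d) :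
  measurable_fun setT (fun x : torus_point R d => tnth x i).
Proof. exact: (@measurable_tnth _ (measurableTypeR R)). Qed.

Lemma lipschitz_periodic_curve d L (K : torus_point R d -> R) Q : 0 <= L -> lipschitz_periodic L K ->
  exists2 L', 0 <= L' & lipschitz_periodic L' (fun x : torus_point R 1 => K (curve d Q (tnth x ord0))).
Proof.
move=> L0 [mK uK lK pK]; have [M [M0 cM]] := curve_lipschitz R d Q.
exists (L * M); first exact: mulr_ge0.
split => //.
- apply: measurableT_comp => //; apply: measurableT_comp; first exact: measurable_curve.
  exact: measurable_coord.
- move=> x x'; rewrite (le_trans (lK _ _))// -mulrA ler_wpM2l//.
  by rewrite (le_trans (cM _ _))// /dist1 big_ord1.
- move=> x x' xx'; apply: pK; have [m ->] := xx' ord0; exact: curve_periodic.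
Qed.

Definition tail d (x : torus_point R d.+1) : torus_point R d := [tuple of behead x].

Lemma tail_cons d y (x : torus_point R d) : tail (cons_point (y, x)) = x.
Proof. exact: val_inj. Qed.

Lemma tnth_tail d (x : torus_point R d.+1) i : tnth (tail x) i = tnth x (lift ord0 i).
Proof. by rewrite !(tnth_nth 0) nth_behead lift0. Qed.

Lemma lipschitz_periodic_head d L (F : torus_point R 1 -> R) : 0 <= L -> lipschitz_periodic L F ->
  lipschitz_periodic L (fun z : torus_point R d.+1 => F (point1 (tnth z ord0))).
Proof.
move=> L0 [mF uF lF pF]; split => //.
- apply: measurableT_comp => //; apply: measurable_torus => i.
  rewrite ord1; exact: measurable_coord.
- move=> x x'; rewrite (le_trans (lF _ _))// ler_wpM2l//.
  by rewrite /dist1 big_ord1 big_ord_recl lerDl sumr_ge0.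
- by move=> x x' xx'; apply: pF => i; rewrite ord1; exact: xx'.
Qed.

Lemma lipschitz_periodic_tail d L (K : torus_point R d -> R) : 0 <= L -> lipschitz_periodic L K ->
  lipschitz_periodic L (fun z => K (tail z)).
Proof.
move=> L0 [mK uK lK pK]; split => //.
- apply: measurableT_comp => //; apply: measurable_torus => i.
  rewrite (_ : (fun _ => _) = (fun x => tnth x (lift ord0 i))); first exact: measurable_coord.
  by apply/funext => x; rewrite tnth_tail.
- move=> x x'; rewrite (le_trans (lK _ _))// ler_wpM2l//.
  rewrite /dist1 [leRHS]big_ord_recl.
  under eq_bigr do rewrite !tnth_tail.
  by rewrite lerDr.
- by move=> x x' xx'; apply: pK => i; rewrite !tnth_tail; exact: xx'.
Qed.

End LipschitzTransfer.

(** [mkseq Q j] is the list of the values chosen before the [j]-th. *)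
Lemma history_choice (A : seq nat -> nat -> Prop) :
  (forall s, exists q, A s q) -> exists Q : nat -> nat, forall j, A (mkseq Q j) (Q j).
Proof.
move=> /choice[f hf].
pose s j := iter j (fun s => rcons s (f s)) [::].
have sE j : mkseq (fun j => f (s j)) j = s j.
  by elim: j => [//|j IH]; rewrite mkseqS IH.
by exists (fun j => f (s j)) => j; rewrite sE; exact: hf.
Qed.

Section Independence.
Variables (R : realType) (d : nat).
Local Notation U := (uniform_prob (@ltr01 R)).
Local Notation mu := (torus_measure R).

(** Asymptotic independence: a fixed function on the circle, here that of the
    earlier blocks, decorrelates from an observable of the torus that is read
    along a fast curve. *)
Lemma mean_curve_mul L1 L2 (F : torus_point R 1 -> R) (K : torus_point R d -> R) Q :
  (0 < Q)%N -> 0 <= L1 -> 0 <= L2 ->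
  lipschitz_periodic L1 F -> lipschitz_periodic L2 K ->
  `|\int[mu 1]_x (F x * K (curve d Q (tnth x ord0))) -
    \int[mu 1]_x F x * \int[mu d]_x K x| <= d%:R * ((L1 + L2) / Q%:R).
Proof.
move=> Q0 L10 L20 lF lK.
have lFK := lipschitz_periodicM (lipschitz_periodic_head d L10 lF) (lipschitz_periodic_tail L20 lK).
have := mean_curve Q0 (addr_ge0 L10 L20) lFK.
rewrite mean_torusS; last exact: lipschitz_periodic_bounded lFK.
have [L3 L30 lKc] := lipschitz_periodic_curve Q L20 lK.
have bF := lipschitz_periodic_bounded lF; have bK := lipschitz_periodic_bounded lK.
have -> : \int[mu 1]_x (F x * K (curve d Q (tnth x ord0))) =
    \int[U]_y (F (point1 (tnth (cons_point (y, curve d Q y)) ord0)) *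
               K (tail (cons_point (y, curve d Q y)))).
  rewrite mean_torus1; last exact: lipschitz_periodic_bounded (lipschitz_periodicM lF lKc).
  by apply: eq_Rintegral => y _; rewrite tail_cons.
suff -> : \int[mu 1]_x F x * \int[mu d]_x K x =
    \int[U]_y \int[mu d]_x (F (point1 (tnth (cons_point (y, x)) ord0)) *
               K (tail (cons_point (y, x)))) by [].
have -> : \int[mu 1]_x F x = \int[U]_y F (point1 y) by rewrite mean_torus1.
rewrite mulrC -meanZ; last first.
  split; last by have [_ [M FM]] := bF; exists M.
  apply: measurableT_comp; first exact: bF.1.
  by apply: measurable_torus => i; rewrite ord1; exact: measurable_id.
apply: eq_Rintegral => y _; rewrite mulrC -meanZ//.
by apply: eq_Rintegral => x _; rewrite tail_cons.
Qed.

Lemma prod_le_inv (h : nat -> R) (m J : nat) :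
  (forall j, 0 <= h j <= 1) -> 
  \prod_(m <= j < J) h j <= (1 + \sum_(m <= j < J) (1 - h j))^-1.
Proof.
move=> h01.
have S0 : 0 <= \sum_(m <= j < J) (1 - h j).
  by apply: sumr_ge0 => j _; rewrite subr_ge0; have /andP[] := h01 j.
apply: (@le_trans _ _ (expR (- \sum_(m <= j < J) (1 - h j)))).
  rewrite -sumrN expR_sum; apply: ler_prod => j _.
  have /andP[-> h1] := h01 j; rewrite opprB.
  by rewrite /= (le_trans _ (expR_ge1Dx _))// addrC subrK.
rewrite expRN lef_pV2 ?posrE ?expR_gt0//; first exact: expR_ge1Dx.
by rewrite ltr_pwDl.
Qed.

(** A second Borel-Cantelli lemma. Think of [K j] as the indicator that the
    [j]-th block is small. If the probabilities [1 - E (K j)] had a divergent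
    sum, choose [Q] growing so fast that the mean over the circle of the product
    of the transferred [K j], [m <= j < J], exceeds the product of their means
    on the torus by [O(2^-m)] at most. The latter tends to 0 as [J] grows, so for a
    suitable [J m] the product over [m <= j < J m] has mean [O(2^-m)] and tends
    to 0 almost everywhere as [m] grows. But by assumption it is eventually
    equal to 1. The predicate [A] leaves room for further growth conditions on
    [Q]. *)
Lemma transfer_dichotomy (K : nat -> torus_point R d -> R) (L : nat -> R)
    (A : seq nat -> nat -> Prop) :
  (forall j, 0 <= L j) -> (forall j, lipschitz_periodic (L j) (K j)) ->
  (forall s, exists q0, forall q, (q0 <= q)%N -> A s q) ->
  (forall Q : nat -> nat, (forall j, A (mkseq Q j) (Q j)) ->
    {ae mu 1, forall x, exists J, forall j, (J <= j)%N ->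
       K j (curve d (Q j) (tnth x ord0)) = 1}) ->
  exists M, forall n, \sum_(j < n) (1 - \int[mu d]_x K j x) <= M.
Proof.
move=> L0 lK Aev hae; apply: contrapT => /forallNP unbounded.
pose h j := \int[mu d]_x K j x.
have h01 j : 0 <= h j <= 1.
  have bK := lipschitz_periodic_bounded (lK j); apply/andP; split.
    by apply: mean_ge0 => x; have /andP[] := lp_unit (lK j) x.
  by apply: mean_le1 => // x; have /andP[] := lp_unit (lK j) x.
have h0 j : 0 <= h j by have /andP[] := h01 j.
have h1 j : h j <= 1 by have /andP[] := h01 j.
have [Lt hLt] : exists Lt : nat -> nat -> R, forall j q, 0 <= Lt j q /\
    lipschitz_periodic (Lt j q) (fun x : torus_point R 1 => K j (curve d q (tnth x ord0))).
  have e (jq : nat * nat) : exists L', 0 <= L' /\ lipschitz_periodic L'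
      (fun x : torus_point R 1 => K jq.1 (curve d jq.2 (tnth x ord0))).
    by have [L' ? ?] := lipschitz_periodic_curve jq.2 (L0 jq.1) (lK jq.1); exists L'.
  by have [Lt hLt] := choice e; exists (fun j q => Lt (j, q)) => j q; exact: (hLt (j, q)).
(* Lam s bounds the Lipschitz constant of every product of the blocks already
   transferred, whatever its first factor, so one choice of the next speed
   serves for all m at once. *)
pose Lam (s : seq nat) := \sum_(0 <= i < size s) Lt i (nth 0%N s i).
have [Q hQ] : exists Q : nat -> nat, forall j,
    A (mkseq Q j) (Q j) /\ ((0 < Q j)%N /\
    d%:R * ((Lam (mkseq Q j) + L j) / (Q j)%:R) <= (2^-1) ^+ j).
  suff /history_choice[Q hQ] : forall s, exists q, A s q /\ ((0 < q)%N /\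
      d%:R * ((Lam s + L (size s)) / q%:R) <= (2^-1) ^+ (size s)).
    by exists Q => j; have := hQ j; rewrite size_mkseq.
  move=> s; have [q0 hq0] := Aev s.
  pose c := d%:R * (Lam s + L (size s)) * 2 ^+ (size s).
  have c0 : 0 <= c.
    rewrite !mulr_ge0// ?exprn_ge0// addr_ge0// sumr_ge0// => i _.
    by have [] := hLt i (nth 0%N s i).
  pose q := maxn q0 (Num.bound c).+1.
  have qp : 0 < q%:R :> R by rewrite ltr0n /q leq_max orbT.
  exists q; split; first by apply: hq0; rewrite leq_maxl.
  split; first by rewrite -(ltr0n R).
  rewrite mulrA exprVn ler_pdivrMr// ler_pdivlMl ?exprn_gt0// mulrC.
  apply: (@le_trans _ _ (Num.bound c)%:R).
    by have := archi_boundP c0; rewrite /c => /ltW.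
  by rewrite ler_nat /q (leq_trans _ (leq_maxr _ _)).
pose g j (x : torus_point R 1) := K j (curve d (Q j) (tnth x ord0)).
have lg j : lipschitz_periodic (Lt j (Q j)) (g j) by have [] := hLt j (Q j).
pose F m J (x : torus_point R 1) := \prod_(m <= j < J) g j x.
have lF m J : lipschitz_periodic (\sum_(m <= j < J) Lt j (Q j)) (F m J).
  by apply: lipschitz_periodic_prod => i _; exact: lg.
have Lt0 j q : 0 <= Lt j q by have [] := hLt j q.
pose I m J := \int[mu 1]_x F m J x.
have I0 m J : 0 <= I m J.
  by apply: mean_ge0 => x; have /andP[] := lp_unit (lF m J) x.
have Istep m J : (m <= J)%N -> `|I m J.+1 - I m J * h J| <= (2^-1) ^+ J.
  move=> mJ; have [_ [Q0 Qs]] := hQ J.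
  have E x : F m J.+1 x = F m J x * K J (curve d (Q J) (tnth x ord0)).
    by rewrite /F big_nat_recr.
  have -> : I m J.+1 = \int[mu 1]_x (F m J x * K J (curve d (Q J) (tnth x ord0))).
    by apply: eq_Rintegral => x _; exact: E.
  have S0 : 0 <= \sum_(m <= j < J) Lt j (Q j) by apply: sumr_ge0.
  apply: (le_trans (mean_curve_mul Q0 S0 (L0 J) (lF m J) (lK J))).
  apply: le_trans Qs; rewrite ler_wpM2l// ler_pM2r ?invr_gt0 ?ltr0n// lerD2r.
  rewrite /Lam size_mkseq (@big_cat_nat _ _ _ m 0 J)//= -[leLHS]add0r.
  apply: lerD; first exact: sumr_ge0.
  apply: ler_sum_nat => j /andP[_ jJ].
  by rewrite nth_mkseq.
have Ile m J : (m <= J)%N ->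
    I m J <= \prod_(m <= j < J) h j + \sum_(m <= j < J) (2^-1) ^+ j.
  elim: J => [|J IH].
    rewrite leqn0 => /eqP ->; rewrite !big_geq// addr0.
    by apply: mean_le1; [exact: lipschitz_periodic_bounded (lF _ _)|] => x; have /andP[] := lp_unit (lF 0 0) x.
  rewrite leq_eqVlt => /predU1P[->|].
    rewrite !big_geq// addr0.
    by apply: mean_le1; [exact: lipschitz_periodic_bounded (lF _ _)|] => x; have /andP[] := lp_unit (lF J.+1 J.+1) x.
  rewrite ltnS => mJ; rewrite !big_nat_recr//=.
  have := Istep m J mJ; rewrite ler_norml => /andP[_].
  rewrite lerBlDr => /le_trans; apply; rewrite [leLHS]addrC [leRHS]addrA lerD2r.
  apply: (le_trans (ler_wpM2r (h0 J) (IH mJ))); rewrite mulrDl lerD2l.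
  by rewrite ler_piMr// sumr_ge0// => j _; rewrite exprn_ge0// invr_ge0.
(* Each 1 - h j is at most 1, so dropping the first m terms of the divergent
   sum costs at most m. *)
have exJ m : exists J, I m J <= 3 * (2^-1) ^+ m.
  have /existsNP[n /negP] := unbounded (2 ^+ m + m%:R); rewrite -ltNge => hn.
  have count k : \sum_(0 <= j < k) (1 - h j) <= k%:R.
    apply: (@le_trans _ _ (\sum_(0 <= j < k) 1)).
      by apply: ler_sum => j _; rewrite lerBlDr lerDl.
    by rewrite big_mkord sumr_const card_ord.
  rewrite -(big_mkord xpredT (fun j => 1 - h j)) in hn.
  have mn : (m <= n)%N.
    rewrite leqNgt; apply/negP => nm.
    have := lt_le_trans hn (count n); rewrite ltNge => /negP; apply.
    by rewrite -[leLHS]add0r lerD// ?exprn_ge0// ler_nat ltnW.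
  exists n; apply: (le_trans (Ile m n mn)).
  rewrite (_ : 3 = 1 + 2 :> R); last by ring.
  rewrite mulrDl mul1r lerD ?geometric_sum_le//.
  apply: (le_trans (prod_le_inv m n h01)).
  rewrite exprVn lef_pV2 ?posrE ?exprn_gt0//; last first.
    by rewrite ltr_pwDl// sumr_ge0// => j _; rewrite subr_ge0.
  move: hn; rewrite (@big_cat_nat _ _ _ m 0 n)//= => hn.
  have := count m; move: hn; set S := \sum_(m <= j < n) _; set S' := \sum_(0 <= j < m) _.
  lra.
have [J hJ] := choice exJ.
have ae0 : {ae mu 1, forall x, cvgn (series (fun m => F m (J m) x))}.
  apply: (@ae_summable _ _ _ (mu 1) (fun m => F m (J m)) (3 * 2)).
  - by move=> m; exact: lipschitz_periodic_bounded (lF _ _).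
  - by move=> m x; have /andP[] := lp_unit (lF m (J m)) x.
  move=> n; apply: (@le_trans _ _ (\sum_(0 <= m < n) 3 * (2^-1) ^+ m)).
    by rewrite big_mkord; apply: ler_sum => m _; exact: hJ.
  rewrite -mulr_sumr ler_wpM2l// (le_trans (geometric_sum_le _ _ _))//.
  by rewrite expr0 mulr1.
have ae1 := hae Q (fun j => (hQ j).1).
have mu1 : (0 < mu 1 [set: torus_point R 1])%E.
  by have /= -> := @probability_setT _ _ _ (mu 1).
have PF := ae_properfilter_algebraOfSetsType mu1.
suff : {ae mu 1, forall x : torus_point R 1, False}.
  by move=> /(@filter_ex _ _ PF)[].
apply: filterS2 ae0 ae1 => x cx [J0 hJ0].
have := cvg_series_cvg_0 cx => /cvgrPdist_lt/(_ 1 ltr01)[K0 _ hK].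
have := hK (maxn J0 K0) (leq_maxr _ _).
rewrite /F big_nat big1 ?sub0r ?normrN ?normr1 ?ltxx// => j /andP[jm _].
by apply: hJ0; rewrite (leq_trans _ jm)// leq_maxl.
Qed.

End Independence.

(** * Transfer of a series to the circle *)

Lemma finite_bound (G : nat -> {fset nat}) (F : nat -> nat -> nat) (n : nat) :
  exists B, forall i k, (i < n)%N -> k \in G i -> (F i k <= B)%N.
Proof.
exists (\sum_(i < n) \sum_(k <- G i) F i k)%N => i k ltin ki.
rewrite (bigD1 (Ordinal ltin))//= (leq_trans _ (leq_addr _ _))//.
by rewrite (big_rem k)//= leq_addr.
Qed.

Section Transfer.
Variables (R : realType) (d : nat).
Local Notation mu := (torus_measure R).
Variables (e : nat -> d.-tuple int) (G : nat -> {fset nat}) (a b : nat -> R[i]).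
Hypothesis e_inj : injective e.

Definition separates (rho : nat -> nat -> 1.-tuple int) :=
  forall m n k l, k \in G m -> l \in G n -> rho m k = rho n l -> k = l.

Hypothesis transferred_cvg : forall rho, separates rho ->
  {ae mu 1, forall x, cvgn (series (fun n =>
     a n * \sum_(k <- G n) b k * trig_fun (rho n k) x : R[i]^o))}.

Let p (n : nat) (x : torus_point R d) : R[i] :=
  \sum_(k <- G n) b k * trig_fun (e k) x.

Let tame_p n : tame (p n).
Proof. by apply: tame_sum => k; apply: tameZ; exact: tame_trig. Qed.

Variable N : nat -> nat.
Hypotheses (N0 : N 0%N = 0%N) (NS : forall j, (N j < N j.+1)%N).

(** [transfer_dichotomy] is applied to the product [K j], over the [k] of the
    [j]-th block, of the cutoffs of the partial sums up to [k]: it is 1 when all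
    of them are at most [r], and when it is positive all of them are less than
    [2 r]. The growth conditions [A] on [Q] make the transferred frequencies
    distinct, within a block by [freq_inj] and across blocks by [freq_eq0]. *)
Lemma maximal_block_small (r : R) : 0 < r ->
  {ae mu d, forall x, exists J, forall j k, (J <= j)%N -> (N j <= k < N j.+1)%N ->
    norm1 (\sum_(N j <= i < k.+1) a i * p i x) <= 2 * r}.
Proof.
move=> r0.
pose S j k x := \sum_(N j <= i < k.+1) a i * p i x.
have tS j k : tame (S j k) by apply: tame_sum => i; exact: tameZ.
pose K j x := \prod_(N j <= k < N j.+1) cutoff r (norm1 (S j k x)).
have exL j : exists L, 0 <= L /\ lipschitz_periodic L (K j).
  have [l hl] := choice (fun k => lipschitz_periodic_cutoff r0 (tS j k)).
  exists `|\sum_(N j <= k < N j.+1) l k|; split => //.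
  by apply: (lipschitz_periodicW (ler_norm _)); apply: lipschitz_periodic_prod => k _; exact: hl.
have [L hL] := choice exL.
have [blk hblk] := choice (block_exists N0 NS).
pose A (s : seq nat) (q : nat) :=
  (exists B, (2 * B < q)%N /\ forall i k c, (i < N (size s).+1)%N -> k \in G i ->
      `|tnth (e k) c| <= B%:Z) /\
  (forall i k, (i < N (size s))%N -> k \in G i ->
      `|freq (nth 0%N s (blk i)) (e k)| < q%:Z).
have Aev s : exists q0, forall q, (q0 <= q)%N -> A s q.
  have [B hB] := finite_bound G (fun _ k => \max_(c < d) `|tnth (e k) c|)%N (N (size s).+1).
  have [B' hB'] := finite_bound G (fun i k => `|freq (nth 0 s (blk i)) (e k)|)%N (N (size s)).
  exists (2 * B + B').+1 => q hq; split.
    exists B; split; first by rewrite (leq_trans _ hq)// ltnS leq_addr.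
    move=> i k c iN ki; rewrite -abszE lez_nat (leq_trans _ (hB i k iN ki))//.
    exact: (leq_bigmax c).
  move=> i k iN ki; rewrite -abszE ltz_nat (leq_ltn_trans (hB' i k iN ki))//.
  by rewrite (leq_trans _ hq)// ltnS leq_addl.
have KQ (Q : nat -> nat) : (forall j, A (mkseq Q j) (Q j)) ->
    {ae mu 1, forall x, exists J, forall j, (J <= j)%N ->
       K j (curve d (Q j) (tnth x ord0)) = 1}.
  move=> AQ; pose rho n k := [tuple freq (Q (blk n)) (e k)].
  have sep : separates rho.
    (* In two different blocks only the frequency 0 can have equal images: the
       image in the later block is smaller than its speed, hence 0, and
       then both frequencies vanish. *)
    have same m n k l : (blk m <= blk n)%N -> k \in G m -> l \in G n ->
        freq (Q (blk m)) (e k) = freq (Q (blk n)) (e l) -> e k = e l.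
      move=> mn km ln fkl.
      have [[B [BQ hB]] hprev] := AQ (blk n).
      rewrite size_mkseq in hB hprev.
      have nN : (n < N (blk n).+1)%N by have /andP[] := hblk n.
      have [bmn|bmn] := eqVneq (blk m) (blk n).
        rewrite bmn in fkl; apply: (freq_inj _ _ BQ fkl) => c.
          by apply: (hB m) => //; rewrite -bmn; have /andP[] := hblk m.
        exact: (hB n).
      have ltmn : (blk m < blk n)%N by rewrite ltn_neqAle bmn.
      have mN : (m < N (blk n))%N.
        have /andP[_ h] := hblk m; exact: leq_trans h (block_mono NS ltmn).
      have := hprev m k mN km; rewrite nth_mkseq// fkl => small.
      have fl0 := freq_eq0 small.
      have zeroB (B' : nat) c : `|tnth [tuple 0 | i < d] c : int| <= B'%:Z.
        by rewrite tnth_mktuple normr0.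
      have f0 q : freq q [tuple (0 : int) | i < d] = 0.
        by rewrite /freq big1// => c _; rewrite tnth_mktuple mul0r.
      have -> : e l = [tuple 0 | i < d].
        apply: (freq_inj _ _ BQ); [|exact: zeroB|by rewrite fl0 f0].
        by move=> c; exact: (hB n).
      have [[B' [BQ' hB'']] _] := AQ (blk m); rewrite size_mkseq in hB''.
      apply: (freq_inj _ _ BQ'); [|exact: zeroB|by rewrite fkl fl0 f0].
      by move=> c; apply: (hB'' m) => //; have /andP[] := hblk m.
    move=> m n k l km ln /(congr1 (fun t => tnth t ord0)) /= fkl.
    have {}fkl : freq (Q (blk m)) (e k) = freq (Q (blk n)) (e l) by exact: fkl.
    apply: e_inj; have [mn|/ltnW nm] := leqP (blk m) (blk n).
      exact: same fkl.
    by apply/esym; apply: (same n m).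
  apply: filterS (transferred_cvg sep) => x cx.
  have [J hJ] := small_blocks_of_cvg NS cx r0.
  exists J => j Jj; rewrite /K big_nat big1// => k kj.
  apply: cutoff_small => //.
  have := hJ j k Jj kj; congr (norm1 _ <= _).
  apply: eq_big_nat => i /andP[ji ik]; congr (_ * _); apply: eq_bigr => l _.
  congr (_ * _); rewrite trig_curve -point1_tnth /rho.
  suff -> : blk i = j by [].
  apply: (block_unique NS (hblk i)); rewrite ji/=.
  by have /andP[_] := kj; apply: leq_ltn_trans.
have [M hM] := transfer_dichotomy (fun j => (hL j).1) (fun j => (hL j).2) Aev KQ.
have bK j : bounded_measurable (fun x => 1 - K j x).
  by apply: bounded_measurableB; [exact: bounded_measurable_cst|exact: lipschitz_periodic_bounded (hL j).2].
have : {ae mu d, forall x, cvgn (series (fun j => 1 - K j x))}.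
  apply: (@ae_summable _ _ _ (mu d) (fun j x => 1 - K j x) M) => //.
    by move=> j x; rewrite subr_ge0; have /andP[] := lp_unit (hL j).2 x.
  move=> n; rewrite (le_trans _ (hM n))//; apply: ler_sum => j _.
  rewrite meanB ?mean_cst//; first exact: bounded_measurable_cst.
  exact: lipschitz_periodic_bounded (hL j).2.
apply: filterS => x /cvg_series_cvg_0/cvgrPdist_lt/(_ 1 ltr01)[J _ hJ].
exists J => j k Jj kj; have := hJ j Jj; rewrite /= sub0r normrN => K1.
have Kpos : 0 < K j x.
  have /andP[K0 K1'] := lp_unit (hL j).2 x.
  by move: K1; rewrite ger0_norm ?subr_ge0//; lra.
apply/ltW/(cutoff_gt0 r0).
have /andP[c0 _] := cutoff01 r (norm1 (S j k x)).
rewrite lt_def c0 andbT; apply: contraTneq Kpos => ck.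
rewrite /K (bigD1_seq k) ?mem_index_iota ?iota_uniq//= -/(S j k x) ck mul0r ltxx//.
Qed.

End Transfer.

(** * Comparison of the multipliers *)

Section TransferTheorem.
Variable R : realType.
Local Notation mu := (torus_measure R).

Lemma cvg_series_ext (u v : nat -> R[i]) : u =1 v ->
  cvgn (series u : nat -> R[i]^o) -> cvgn (series v : nat -> R[i]^o).
Proof. by move=> /funext ->. Qed.

(** The two halves of the argument put together; [RC] and [SRC] multipliers only
    differ in how they provide the convergence on the circle. *)
Lemma cvg_of_transferred d (e : nat -> d.-tuple int) (G : nat -> {fset nat})
    (b : nat -> R[i]) (w : nat -> R) (a : nat -> R[i]) :
  injective e -> weight_sequence w ->
  (forall m n, inner (mu d) (polynomials (fun k => trig_fun (e k)) G b m)
     (polynomials (fun k => trig_fun (e k)) G b n) = (m == n)%:R) ->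
  (\sum_(0 <= k <oo) ((Normc.normc (a k)) ^+ 2 * w k.+1)%:E < +oo)%E ->
  (forall rho, separates G rho -> {ae mu 1, forall x, cvgn (series (fun n =>
     a n * \sum_(k <- G n) b k * trig_fun (rho n k) x : R[i]^o))}) ->
  {ae mu d, forall x, cvgn (series (fun n =>
     a n * polynomials (fun k => trig_fun (e k)) G b n x : R[i]^o))}.
Proof.
move=> e_inj ww orth aw cv.
have [N [N0 NS wN]] := weight_blocks ww.
have bp n : cbounded (polynomials (fun k => trig_fun (R := R) (e k)) G b n).
  apply: cbounded_sum => k; apply: cboundedZ; exact: cbounded_trig.
have ae1 := block_sums_summable ww wN aw bp orth.
have inv0 m : 0 < m.+1%:R^-1 :> R by rewrite invr_gt0.
have ae2 := ae_foralln (fun m => maximal_block_small e_inj cv N0 NS (inv0 m)).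
apply: filterS2 ae1 ae2 => x c1 c2; apply: (cvg_series_blocks N0 NS c1) => r r0.
have [J hJ] := c2 (Num.bound (2 / r)); exists J => j k Jj kj.
apply: (le_trans (hJ j k Jj kj)).
have := archi_boundP (divr_ge0 (ler0n R 2) (ltW r0)).
rewrite ltr_pdivrMr// => h; rewrite ler_pdivrMr// (le_trans (ltW h))// mulrC.
by rewrite ler_pM2l// ler_nat.
Qed.

(** A null set of the torus containing the cylinder over the exceptional points
    has fibers of full measure over each of them, and the mean of the measures of
    its fibers is 0. Working with a null set of the torus avoids any measurability
    requirement on [S]. *)
Lemma ae_first_coordinate d (S : torus_point R 1 -> Prop) :
  {ae mu d.+1, forall x, S (point1 (tnth x ord0))} -> {ae mu 1, forall x, S x}.
Proof.
move=> [A [mA A0 SA]].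
have bA : bounded_measurable (\1_A : torus_point R d.+1 -> R).
  split; first exact: measurable_indic.
  by exists 1 => x; rewrite indicE normr_nat; case: (_ \in _).
pose psi (y : R) := \int[mu d]_x (\1_A (cons_point (y, x)) : R).
have bpsi : bounded_measurable psi := bounded_fiber_mean bA.
have psi0 y : 0 <= psi y by apply: mean_ge0 => x; rewrite indicE.
have Epsi : \int[uniform_prob (@ltr01 R)]_y psi y = 0.
  rewrite -(mean_torusS bA); apply: EFin_inj; rewrite (EFin_mean _ bA).
  by rewrite integral_indic// setIT.
have bpsi1 : bounded_measurable (fun x : torus_point R 1 => psi (tnth x ord0)).
  split; last by have [_ [M hM]] := bpsi; exists M => x.
  apply: measurableT_comp; first exact: bpsi.1.
  exact: measurable_coord.
have ae0 : {ae mu 1, forall x, cvgn (series (fun _ : nat => psi (tnth x ord0)))}.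
  apply: (@ae_summable _ _ _ (mu 1) (fun _ x => psi (tnth x ord0)) 0) => //.
  by move=> n; rewrite big1// => k _; rewrite mean_torus1.
have FF := ae_filter_ringOfSetsType (mu 1).
apply: filterS ae0 => x /cvg_series_cvg_0 cx; apply: contrapT => nSx.
have psi1 : psi (tnth x ord0) = 1.
  rewrite -[RHS](mean_cst (mu d)); apply: eq_Rintegral => z _.
  rewrite indicE mem_set//; apply: SA => /= h; apply: nSx.
  by rewrite (point1_tnth x).
move: cx => /cvgrPdist_lt/(_ 1 ltr01)[K _ /(_ K (leqnn K))].
by rewrite psi1 sub0r normrN normr1 ltxx.
Qed.

Lemma inner_trig_sums d (s t : seq nat) (b : nat -> R[i]) (f g : nat -> d.-tuple int) :
  inner (mu d) (fun x => \sum_(k <- s) b k * trig_fun (f k) x)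
               (fun x => \sum_(l <- t) b l * trig_fun (g l) x) =
  \sum_(k <- s) \sum_(l <- t) b k * conjc (b l) * (f k == g l)%:R.
Proof.
rewrite inner_sum; [|by move=> k; exact: cbounded_trig..].
by apply: eq_bigr => k _; apply: eq_bigr => l _; rewrite inner_trig.
Qed.

Definition embed d (n : 1.-tuple int) : d.+1.-tuple int :=
  [tuple of tnth n ord0 :: nseq d 0].

Lemma embed_inj d : injective (@embed d).
Proof.
move=> m n /(congr1 (fun t => tnth t ord0)) mn.
by apply: eq_from_tnth => i; rewrite ord1; exact: mn.
Qed.

Lemma trig_embed d (n : 1.-tuple int) (x : torus_point R d.+1) :
  trig_fun (embed d n) x = trig_fun n (point1 (tnth x ord0)).
Proof.
rewrite !trig_funE.
suff -> : phase (tnth (embed d n)) x = phase (tnth n) (point1 (tnth x ord0)) by [].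
rewrite /phase big_ord_recl big_ord1; congr (_ * _).
rewrite [X in _ + X]big1 ?addr0// => i _.
by rewrite tnthS tnth_nseq mul0r.
Qed.

Lemma RC_multiplier_embedding d (w : nat -> R) (e1 : nat -> 1.-tuple int)
    (ed : nat -> d.+1.-tuple int) : bijective e1 -> bijective ed ->
  RC_multiplier (mu d.+1) (fun k => trig_fun (ed k)) w ->
  RC_multiplier (mu 1) (fun k => trig_fun (e1 k)) w.
Proof.
move=> be1 [edi edK ediK] [ww rc]; split => // nk nk_inj; split => // a aw.
have e1_inj := bij_inj be1.
pose m k := edi (embed d (e1 (nk k))).
have m_inj : injective m.
  by move=> k l /(can_inj ediK)/embed_inj/e1_inj/nk_inj.
have [_ /(_ a aw) ae] := rc m m_inj.
have FF := ae_filter_ringOfSetsType (mu d.+1).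
apply: (@ae_first_coordinate d); apply: filterS ae => x.
apply: cvg_series_ext => k /=.
by rewrite /m ediK trig_embed.
Qed.

Lemma RC_multiplier_transfer d (w : nat -> R) (e1 : nat -> 1.-tuple int)
    (ed : nat -> d.-tuple int) : bijective e1 -> bijective ed ->
  RC_multiplier (mu 1) (fun k => trig_fun (e1 k)) w ->
  RC_multiplier (mu d) (fun k => trig_fun (ed k)) w.
Proof.
move=> [e1i e1K e1iK] bed [ww rc]; split => // nk nk_inj; split => // a aw.
have ed_inj := bij_inj bed.
pose G n := [fset nk n]%fset.
have pE d' (f : nat -> d'.-tuple int) n :
    polynomials (fun k => trig_fun (R := R) (f k)) G (fun=> 1) n = trig_fun (f (nk n)).
  by apply/funext => x; rewrite /polynomials big_seq_fset1 mul1r.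
have orth m n : inner (mu d) (polynomials (fun k => trig_fun (ed k)) G (fun=> 1) m)
     (polynomials (fun k => trig_fun (ed k)) G (fun=> 1) n) = (m == n)%:R.
  by rewrite !pE inner_trig (inj_eq ed_inj) (inj_eq nk_inj).
have FF := ae_filter_ringOfSetsType (mu d).
suff cv rho : separates G rho -> {ae mu 1, forall x, cvgn (series (fun n =>
    a n * \sum_(k <- G n) 1 * trig_fun (rho n k) x : R[i]^o))}.
  apply: filterS (cvg_of_transferred ed_inj ww orth aw cv) => x.
  by apply: cvg_series_ext => k; rewrite pE.
move=> sep.
pose m n := e1i (rho n (nk n)).
have m_inj : injective m.
  move=> k l /(can_inj e1iK) kl; apply: nk_inj.
  by apply: sep kl; rewrite /G inE.
have [_ /(_ a aw) ae1] := rc m m_inj.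
have FF1 := ae_filter_ringOfSetsType (mu 1).
apply: filterS ae1 => x; apply: cvg_series_ext => k /=.
by rewrite /m e1iK big_seq_fset1 mul1r.
Qed.

(** Orthonormality of polynomials with disjoint spectra only depends on their
    coefficients, so it survives any change of frequencies, even across
    dimensions, that keeps the frequencies distinct. The map [rho] is inverted on
    the union of the spectra to rewrite the new polynomials in the enumeration
    [E]. *)
Lemma SRC_multiplier_separated d D (w : nat -> R) (e : nat -> d.-tuple int)
    (E : nat -> D.-tuple int) (G : nat -> {fset nat}) (a b : nat -> R[i])
    (rho : nat -> nat -> D.-tuple int) :
  injective e -> bijective E ->
  (forall m n, m != n -> [disjoint G m & G n]%fset) ->
  orthonormal_system (mu d) (polynomials (fun k => trig_fun (e k)) G b) ->
  (forall m n k l, k \in G m -> l \in G n -> rho m k = rho n l -> k = l) ->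
  (\sum_(0 <= k <oo) ((Normc.normc (a k)) ^+ 2 * w k.+1)%:E < +oo)%E ->
  SRC_multiplier (mu D) (fun k => trig_fun (E k)) w ->
  {ae mu D, forall x, cvgn (series (fun n =>
     a n * \sum_(k <- G n) b k * trig_fun (rho n k) x : R[i]^o))}.
Proof.
move=> e_inj [Ei EK EiK] disj [_ orth] sep aw [ww src].
have Ei_inj := can_inj EiK.
have uniqG m n k : k \in G m -> k \in G n -> m = n.
  move=> km kn; apply/eqP/negPn/negP => /disj /fdisjointP/(_ k km).
  by rewrite kn.
pose G' n := [fset Ei (rho n k) | k in G n]%fset.
have exb l : exists c, forall n k, k \in G n -> l = Ei (rho n k) -> c = b k.
  have [[n [k [kn lE]]]|no] := pselect (exists n k, k \in G n /\ l = Ei (rho n k)).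
    exists (b k) => n' k' kn' lE'; congr b; apply: (sep n n') => //.
    by apply: Ei_inj; rewrite -lE.
  by exists 0 => n k kn lE; exfalso; apply: no; exists n, k.
have [b' hb'] := choice exb.
have pE n : polynomials (fun k => trig_fun (R := R) (E k)) G' b' n =
    fun x => \sum_(k <- G n) b k * trig_fun (rho n k) x.
  apply/funext => x; rewrite /polynomials big_imfset/=; last first.
    by move=> k l kn ln /Ei_inj; exact: sep.
  by apply: eq_big_seq => k kn; rewrite EiK (hb' _ n k).
have disj' m n : m != n -> [disjoint G' m & G' n]%fset.
  move=> mn; apply/fdisjointP => l /imfsetP[k /= km ->]; apply/imfsetP => -[k' /= kn].
  move=> /Ei_inj/(sep _ _ _ _ km kn) kk'; move: mn; rewrite (uniqG m n k) ?eqxx//.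
  by rewrite kk'.
have orth' : orthonormal_system (mu D) (polynomials (fun k => trig_fun (E k)) G' b').
  split=> [n|m n].
    rewrite pE.
    have [bre bim] : cbounded (fun x : torus_point R D => \sum_(k <- G n) b k * trig_fun (rho n k) x).
      by apply: cbounded_sum => k; apply: cboundedZ; exact: cbounded_trig.
    by split; exact: bounded_Lfun2.
  rewrite !pE inner_trig_sums -orth inner_trig_sums.
  apply: eq_big_seq => k km; apply: eq_big_seq => l ln; congr (_ * _%:R).
  rewrite (inj_eq e_inj); congr nat_of_bool; apply/eqP/eqP => [|kl]; first exact: sep.
  by rewrite kl (uniqG m n l)// -kl.
have [_ /(_ a aw)] := src G' b' disj' orth'.
by apply: filterS => x; apply: cvg_series_ext => n; rewrite pE.
Qed.

Lemma SRC_multiplier_embedding d (w : nat -> R) (e1 : nat -> 1.-tuple int)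
    (ed : nat -> d.+1.-tuple int) : bijective e1 -> bijective ed ->
  SRC_multiplier (mu d.+1) (fun k => trig_fun (ed k)) w ->
  SRC_multiplier (mu 1) (fun k => trig_fun (e1 k)) w.
Proof.
move=> be1 bed src; have [ww _] := src; split => // G b disj orth; split => // a aw.
have e1_inj := bij_inj be1.
have sep (m n k l : nat) : k \in G m -> l \in G n ->
    embed d (e1 k) = embed d (e1 l) -> k = l.
  by move=> _ _ /embed_inj/e1_inj.
have := SRC_multiplier_separated e1_inj bed disj orth sep aw src.
move=> ae; have FF := ae_filter_ringOfSetsType (mu d.+1).
apply: (@ae_first_coordinate d); apply: filterS ae => x.
apply: cvg_series_ext => n; congr (_ * _).
by apply: eq_bigr => k _; rewrite trig_embed.
Qed.

Lemma SRC_multiplier_transfer d (w : nat -> R) (e1 : nat -> 1.-tuple int)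
    (ed : nat -> d.-tuple int) : bijective e1 -> bijective ed ->
  SRC_multiplier (mu 1) (fun k => trig_fun (e1 k)) w ->
  SRC_multiplier (mu d) (fun k => trig_fun (ed k)) w.
Proof.
move=> be1 bed src; have [ww _] := src; split => // G b disj orth; split => // a aw.
have ed_inj := bij_inj bed.
apply: (cvg_of_transferred ed_inj ww orth.2 aw) => rho sep.
exact: (SRC_multiplier_separated ed_inj be1 disj orth sep aw src).
Qed.

End TransferTheorem.

Local Close Scope complex_scope.
Local Close Scope classical_set_scope.

Theorem theorem1p1 (R : realType) (d : nat) (w : nat -> R) (C : R)
    (e1 : nat -> 1.-tuple int) (ed : nat -> d.-tuple int) :
  (2 <= d)%N ->
  (forall m n : nat, (1 <= m)%N -> (m <= n)%N -> w m <= w n) ->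
  (forall n : nat, (1 <= n)%N -> w (n ^ 2)%N <= C * w n) ->
  bijective e1 -> bijective ed ->
  (RC_multiplier (torus_measure R 1) (fun k => trig_fun (e1 k)) w <->
   RC_multiplier (torus_measure R d) (fun k => trig_fun (ed k)) w) /\
  (SRC_multiplier (torus_measure R 1) (fun k => trig_fun (e1 k)) w <->
   SRC_multiplier (torus_measure R d) (fun k => trig_fun (ed k)) w).
Proof.
case: d ed => // d ed _ _ _ be1 bed; split; split.
- exact: RC_multiplier_transfer.
- exact: RC_multiplier_embedding.
- exact: SRC_multiplier_transfer.
- exact: SRC_multiplier_embedding.
Qed.
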